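(* Consider the system $x_{k+1}=Ax_k+Bu_k+w_k$ with $x_k,w_k\in\mathbb{R}^{n_x}$, $u_k\in\mathbb{R}^{n_u}$, where the pair $(A,B)$ is stabilisable. Let $\mathbb{W}=\{w\in\mathbb{R}^{n_x}\mid Vw\le \bm{1}\}$, with $V\in\mathbb{R}^{n_v\times n_x}$, be a known convex and compact polytope, let $\mathbb{W}_{\rm true}$ be a convex subset of $\mathbb{W}$, and suppose that the disturbance realisations $w_k$ are independent and identically distributed (i.i.d.) according to an unknown probability distribution ${\rm Pr}$ with support $\mathbb{W}_{\rm true}$. Let $\mathcal{I}^w_k$ be the set of i.i.d. disturbance samples (drawn from ${\rm Pr}$) available at time step $k$, and let $\hat{\mathbb{W}}^\star_k$ be the quantified disturbance set computed from $\mathcal{I}^w_k$ (defined in the context). Let $\epsilon,\gamma\in(0,1)$ and let ${\rm e}$ be Euler's number. If $$|\mathcal{I}^w_k|\ \ge\ \frac{1}{\epsilon}\,\frac{{\rm e}}{{\rm e}-1}\Bigl(\ln\frac1\gamma+n_x\Bigr),$$ then $${\rm Pr}\bigl[w^r\in\mathbb{W}_{\rm true}:\ w^r\notin\hat{\mathbb{W}}^\star_k\bigr]\le\epsilon$$ is satisfied with probability no less than $1-\gamma$.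
   Context: Vector inequalities are componentwise, $\bm{1}$ is the all-ones vector, $|\cdot|$ denotes cardinality, and $\oplus$ is the Minkowski sum. For $v\in\mathbb{W}$ and $\alpha\in[0,1]$, $\mathcal{W}(v,\alpha):=(1-\alpha)v\oplus\alpha\mathbb{W}=\{(1-\alpha)v+\alpha w\mid w\in\mathbb{W}\}$. Quantified disturbance set: let $(y^\star_k,\beta^\star_k)$ be the optimiser of the linear program in $(y,\beta)\in\mathbb{R}^{n_x}\times\mathbb{R}$ $$\max_{y,\beta}\ \beta\quad\text{s.t.}\quad -Vy\le(1-\beta)\bm{1}-Vw^s\ \ \forall w^s\in\mathcal{I}^w_k,\qquad Vy\le\beta\bm{1},\quad\beta\in[0,1].$$ Set $\alpha^\star_k=1-\beta^\star_k$, and $v^\star_k=y^\star_k/\beta^\star_k$ if $\beta^\star_k>0$. Then $\hat{\mathbb{W}}^\star_k:=\mathcal{W}(v^\star_k,\alpha^\star_k)$. When $\beta^\star_k=0$, i.e. $\alpha^\star_k=1$, one has $\hat{\mathbb{W}}^\star_k=\mathbb{W}$ regardless of the choice of $v_k^\star\in\mathbb{W}$. (This linear program is equivalent to minimising $\alpha$ over $v\in\mathbb{W}$, $\alpha\in[0,1]$ such that $\mathcal{W}(v,\alpha)$ contains all samples in $\mathcal{I}^w_k$, via $\beta=1-\alpha$, $y=\beta v$.)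
   Formalization: The linear program's optimal y need not be unique (e.g. for a box W), and the bound fails for arbitrary selection; the formal theorem takes ''the optimiser'' to be unique or chosen by lexicographically minimising fixed linear functions of y. *)

(* Defs.v *)
From HB Require Import structures.
From mathcomp Require Import all_boot all_order all_algebra.
From mathcomp Require Import complex.
From mathcomp Require Import all_classical all_reals all_analysis.
Set Implicit Arguments.
Unset Strict Implicit.
Unset Printing Implicit Defensive.
Import Order.TTheory GRing.Theory Num.Theory.
Import numFieldNormedType.Exports.
Local Open Scope classical_set_scope.
Local Open Scope ring_scope.

HB.instance Definition _ (R : realType) (m n : nat) :=
  @isMeasurable.Build (sigma_display (@open 'M[R]_(m, n))) 'M[R]_(m, n)
    <<s @open 'M[R]_(m, n) >> (@sigma_algebra0 _ setT _)
    (@sigma_algebraC 'M[R]_(m, n) _) (@sigma_algebra_bigcup _ setT _).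

Definition schur_stable (R : realType) (n : nat) (A : 'M[R]_n) : Prop :=
  forall l : R[i], eigenvalue (map_mx (real_complex R) A) l -> `|l| < 1.

Definition stabilisable (R : realType) (nx nu : nat)
    (A : 'M[R]_nx) (B : 'M[R]_(nx, nu)) : Prop :=
  exists K : 'M[R]_(nu, nx), schur_stable (A + B *m K).

Definition vle (R : realType) (n : nat) (u v : 'cV[R]_n) : Prop :=
  forall i, u i 0 <= v i 0.

Definition polytope (R : realType) (nv nx : nat) (V : 'M[R]_(nv, nx)) :
    set 'cV[R]_nx :=
  [set w | vle (V *m w) (const_mx 1)].

Definition scaled_set (R : realType) (nx : nat) (W : set 'cV[R]_nx)
    (v : 'cV[R]_nx) (alpha : R) : set 'cV[R]_nx :=
  [set (1 - alpha) *: v + alpha *: w | w in W].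

Section LinearProgram.
Variables (R : realType) (nv nx : nat) (V : 'M[R]_(nv, nx)).
Implicit Types (I : set 'cV[R]_nx) (z : 'cV[R]_nx * R).

Definition lp_feasible I z : Prop :=
  [/\ forall w, I w ->
        vle (- (V *m z.1)) (const_mx (1 - z.2) - V *m w),
      vle (V *m z.1) (const_mx z.2)
    & 0 <= z.2 <= 1].

Definition lp_optimal I z : Prop :=
  lp_feasible I z /\ forall z', lp_feasible I z' -> z'.2 <= z.2.

(** When [z.2 = 0] the scaling factor is 1 and the centre is irrelevant. *)
Definition quantified_set z : set 'cV[R]_nx :=
  scaled_set (polytope V) (if 0 < z.2 then z.2^-1 *: z.1 else 0) (1 - z.2).

Definition lex_lt (m : nat) (u v : 'cV[R]_m) : Prop :=
  exists i : 'I_m, u i 0 < v i 0 /\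
    forall j : 'I_m, (j < i)%N -> u j 0 = v j 0.

(** [opt I] is _the_ optimiser for the sample set [I].  The optimal [beta] is
    unique but the optimal [y] need not be, and an optimiser picked with
    hindsight does not satisfy the scenario bound; as usual, ties are broken by
    lexicographically minimising fixed linear functions of [y], the rows of
    [T].  For [m = 0] the condition says that the optimiser is unique, and
    [T = 1%:M] is the plain lexicographic rule.  Either way [opt I] is
    determined for every [I] that can be sampled, and is there a Borel function
    of the samples; the measurability clause concerns its arbitrary values at
    all other [I]. *)
Definition lp_rule (Wtrue : set 'cV[R]_nx) (m : nat) (T : 'M[R]_(m, nx))
    (opt : set 'cV[R]_nx -> 'cV[R]_nx * R) : Prop :=
  (forall I, finite_set I -> I !=set0 -> I `<=` Wtrue ->
    lp_optimal I (opt I) /\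
    forall z, lp_optimal I z -> z <> opt I ->
      lex_lt (T *m (opt I).1) (T *m z.1)) /\
  (forall N : nat,
    measurable_fun setT (fun s : N.-tuple 'cV[R]_nx => opt [set` s])).

End LinearProgram.

Definition msupport (R : realType) (n : nat)
    (mu : {measure set 'cV[R]_n -> \bar R}) : set 'cV[R]_n :=
  [set x | forall U : set 'cV[R]_n, open U -> U x -> (0 < mu U)%E].

Definition mutually_independent (R : realType) (d d' : measure_display)
    (Omega : measurableType d) (E : measurableType d') (P : probability Omega R)
    (J : eqType) (X : J -> {RV P >-> E}) : Prop :=
  forall (r : seq J) (A : J -> set E), uniq r ->
    (forall j, measurable (A j)) ->
    P [set om | forall j, j \in r -> A j (X j om)] =
    (\prod_(j <- r) P (X j @^-1` A j))%E.

Definition iid_with_law (R : realType) (d d' : measure_display)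
    (Omega : measurableType d) (E : measurableType d') (P : probability Omega R)
    (J : eqType) (X : J -> {RV P >-> E}) (mu : probability E R) : Prop :=
  mutually_independent X /\
  forall j A, measurable A -> distribution P (X j) A = mu A.

(* Main.v *)
Require Import Defs.
From HB Require Import structures.
From mathcomp Require Import all_boot all_order all_algebra.
From mathcomp Require Import all_classical all_reals all_analysis.
From mathcomp Require Import measurable_realfun ring lra zify.
Set Implicit Arguments.
Unset Strict Implicit.
Unset Printing Implicit Defensive.
Import Order.TTheory GRing.Theory Num.Theory.
Import numFieldNormedType.Exports.
Local Open Scope ring_scope.

(**
Every lexicographic optimum of the linear program is determined by at most
nx + 1 samples.  If all the sets of samples could be partitioned into
intervals [[D, E]] with #|D| <= nx + 1, where E consists of the samples that
respect the optimum of D, then counting the sets of each size would give a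
family of linear identities, and a nonnegative combination of them bounds the
number of N-subsets, among N + n samples, whose optimum is violated by at
least th samples: it is at most the number of N-subsets with at most nx
elements in a fixed block of th - 1 samples.

Degenerate programs have no such partition.  It is obtained by relaxing the
constraints of each sample by a small label.  For generic labels the minimal
subsets determining a given optimum are unique, and since the program is
polyhedral, a violated constraint remains violated for small labels, so that
the original count is bounded by the relaxed one.

By exchangeability the count bounds the probability that the optimum of N
samples is violated by at least th of n fresh ones.  As n tends to infinity
Chebyshev's inequality turns the empirical violation frequency into the
violation probability, and the hypergeometric tail is dominated by the
Chernoff bound exp (nx - N eps (1 - 1/e)), which is at most gamma.
*)

(** * Counting through interval partitions *)

Section Differences.
Variable R : realFieldType.
Implicit Types (F : nat -> R) (d k n x c N : nat).

Definition fdiff F x := F x.+1 - F x.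

(** Newton's forward difference formula, by Pascal's rule applied to [F x.+1 = F x + fdiff F x]. *)
Lemma fdiff_newton F x :
  F x = \sum_(n < x.+1) 'C(x, n)%:R * iter n fdiff F 0%N.
Proof.
elim: x F => [|x IH] F; first by rewrite big_ord1 /= mul1r.
have -> : F x.+1 = F x + fdiff F x by rewrite /fdiff addrC subrK.
rewrite (IH F) (IH (fdiff F)) big_ord_recl bin0 [RHS]big_ord_recl bin0 -addrA.
congr (_ + _); under [RHS]eq_bigr => i _ do rewrite binS natrD mulrDl.
rewrite big_split /=; congr (_ + _).
  by rewrite [RHS]big_ord_recr /= bin_small // mul0r addr0; apply: eq_bigr.
by apply: eq_bigr => i _; rewrite -iterSr.
Qed.

Lemma fdiff_newton_iter F k x :
  iter k fdiff F x = \sum_(n < x.+1) 'C(x, n)%:R * iter (n + k) fdiff F 0%N.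
Proof.
by rewrite (fdiff_newton (iter k fdiff F)); apply: eq_bigr => n _; rewrite iterD.
Qed.

(* The number of [N]-subsets of [0, x) with fewer than [d] elements in [c, x). *)
Definition few_above c d N x : R :=
  if (x < c)%N then 'C(x, N)%:R
  else \sum_(i < d) ('C(x - c, i) * 'C(c, N - i))%:R.

Lemma few_above_ge0 c d N x : 0 <= few_above c d N x.
Proof. by rewrite /few_above; case: ifP => _; rewrite ?sumr_ge0. Qed.

(** Pascal's rule. From [c] on, the term with index 0 cancels and the others shift by one, whence
    the drop in [d]. Below [c] the value is a plain binomial coefficient for every [d], including
    [d = 0], and this convention keeps the identity valid at [x.+1 = c]. *)
Lemma fdiff_few_above c d N :
  fdiff (few_above c d.+1 N.+1) =1 few_above c d N.
Proof.
move=> x; rewrite /fdiff /few_above.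
have [xc1|xc1] := ltnP x.+1 c.
  by rewrite (ltn_trans _ xc1) // binS natrD addrC addKr.
have [xc|xc] := ltnP x c.
  have -> : c = x.+1 by apply/eqP; rewrite eqn_leq xc1 xc.
  rewrite subnn big_ord_recl bin0 mul1n subn0 big1 ?addr0.
    by rewrite binS natrD addrC addKr.
  by move=> i _; rewrite /= bin0n mul0n.
rewrite subSn // 2!big_ord_recl /= !bin0 opprD addrACA subrr add0r.
rewrite -sumrB; apply: eq_bigr => i _.
by rewrite /bump !add1n subSS binS mulnDl natrD addrC addKr.
Qed.

Lemma iter_fdiff_few_above c d N k : (k <= d)%N -> (k <= N)%N ->
  iter k fdiff (few_above c d N) =1 few_above c (d - k) (N - k).
Proof.
elim: k => [|k IH] kd kN x; first by rewrite !subn0.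
rewrite iterS {1}/fdiff !IH ?(ltnW kd) ?(ltnW kN) //.
by rewrite -(subnSK kd) -(subnSK kN) -[LHS]/(fdiff _ _) fdiff_few_above.
Qed.

End Differences.

(** * Partitions of the power set into intervals *)

Section IntervalPartition.
Variables (R : realFieldType) (J : finType).
Implicit Types (A D : {set J}) (E : {set J} -> {set J}).

Lemma card_interval D (X : {set J}) n : D \subset X -> (#|D| <= n)%N ->
  #|[set A : {set J} | [&& #|A| == n, D \subset A & A \subset X]]|
  = 'C(#|X| - #|D|, n - #|D|).
Proof.
move=> DX Dn; have <- : #|X :\: D| = (#|X| - #|D|)%N by rewrite cardsDS.
rewrite -cards_draws.
have DK A : D \subset A -> D :|: (A :\: D) = A.
  move=> DA; rewrite finset.setUC finset.setDE finset.setUIl finset.setUC.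
  by rewrite (finset.setUC _ D) finset.setUCr finset.setIT; apply/finset.setUidPr.
rewrite -(card_in_imset (f := fun A => A :\: D)); last first.
  move=> A A'; rewrite !inE => /and3P[_ DA _] /and3P[_ DA' _] eA.
  by rewrite -(DK A) // eA DK.
apply: eq_card => A; rewrite inE; apply/imsetP/andP => [[A' + ->]|[AX /eqP cA]].
  by rewrite inE => /and3P[/eqP <- DA' A'X]; rewrite finset.setSD // cardsDS.
have dA : [disjoint D & A].
  by rewrite disjoint_sym; have := AX; rewrite finset.subsetD => /andP[].
exists (D :|: A); last first.
  rewrite finset.setDUl finset.setDv finset.set0U; apply/esym/finset.setDidPl.
  by rewrite disjoint_sym.
rewrite inE finset.subsetUl finset.subUset DX.
rewrite (fintype.subset_trans AX (finset.subsetDl _ _)) !andbT.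
by rewrite cardsU (finset.disjoint_setI0 dA) cards0 subn0 cA subnKC.
Qed.

Variables (d : nat) (E : {set J} -> {set J}) (cD : {set J} -> {set J}).

(* [cD] partitions the sets of indices into the intervals [[D, E D]], where [D]
   ranges over the fixed points of [cD]. *)
Hypothesis cDP : forall A D,
  (cD A == D) = [&& cD D == D, D \subset A & A \subset E D].
Hypothesis card_cD : forall D, cD D = D -> (#|D| <= d)%N.

Lemma sub_cD D : cD D = D -> D \subset E D.
Proof. by move/eqP; rewrite cDP => /and3P[]. Qed.

Lemma card_cD_fibre D n : cD D = D ->
  #|[set A : {set J} | (#|A| == n) && (cD A == D)]|
  = if (#|D| <= n)%N then 'C(#|E D| - #|D|, n - #|D|) else 0%N.
Proof.
move=> cDD; have DE := sub_cD cDD.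
case: ifPn => [Dn|]; last rewrite -ltnNge => nD.
  by rewrite -card_interval //; apply: eq_card => A; rewrite !inE cDP cDD eqxx.
apply/eqP; rewrite cards_eq0; apply/eqP/setP => A; rewrite !inE cDP cDD eqxx /=.
apply: contraTF nD => /and3P[/eqP <- DA _].
by rewrite -leqNgt subset_leq_card.
Qed.

(** Every [n]-subset lies in exactly one interval. These are the linear identities, one for each
    [n], that the sizes of the interval ends must satisfy. *)
Lemma sum_card_fibres n :
  \sum_(D | cD D == D)
    (if (#|D| <= n)%N then 'C(#|E D| - #|D|, n - #|D|) else 0%N)
  = 'C(#|J|, n).
Proof.
have -> : 'C(#|J|, n) = #|[set A : {set J} | #|A| == n]|.
  by rewrite -card_draws; apply: eq_card => A; rewrite !inE.
rewrite -sum1dep_card [RHS](partition_big cD [pred D | cD D == D]) /=; last first.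
  move=> A _; have := cDP A (cD A); rewrite eqxx => /esym/and3P[/eqP e _ _].
  by rewrite e.
apply: eq_bigr => D /eqP cDD.
by rewrite -card_cD_fibre // -sum1dep_card.
Qed.

(** The identities for all [n] are added with the weights [iter n fdiff F 0]. Newton's formula sums
    the right-hand sides to [F #|J|] and the share of each interval to an iterated difference of
    [F]. *)
Lemma sum_fdiff_fibres (F : nat -> R) :
  \sum_(D | cD D == D) iter #|D| (@fdiff R) F (#|E D| - #|D|)%N = F #|J|.
Proof.
rewrite [RHS]fdiff_newton.
under [RHS]eq_bigr => n _ do rewrite -sum_card_fibres natr_sum mulr_suml.
rewrite exchange_big /=; apply: eq_bigr => D /eqP cDD.
have DE := subset_leq_card (sub_cD cDD); have EJ := max_card (E D).
rewrite fdiff_newton_iter.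
rewrite -(big_mkord xpredT (fun n =>
  (if (#|D| <= n)%N then 'C(#|E D| - #|D|, n - #|D|) else 0%N)%:R *
  iter n (@fdiff R) F 0%N)).
rewrite (big_cat_nat _ (n := #|D|)) //=; last by apply: leq_trans DE (leq_trans EJ _).
rewrite [X in _ = X + _]big_nat [X in _ = X + _]big1 ?add0r; last first.
  by move=> n /andP[_ nD]; rewrite leqNgt nD mul0r.
rewrite -[X in _ = \big[_/_]_(X <= _ < _) _]add0n big_addn big_mkord.
have h : (#|E D| - #|D| < #|J|.+1 - #|D|)%N.
  by rewrite ltn_sub2rE ?ltnS // (leq_trans DE) // leqW.
rewrite (big_ord_widen _ (fun n => 'C(#|E D| - #|D|, n)%:R * iter (n + #|D|) (@fdiff R) F 0%N) h).
rewrite big_mkcond; apply: eq_bigr => n _.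
rewrite leq_addl addnK ltnS; case: leqP => // lt.
by rewrite bin_small // mul0r.
Qed.

(* Dual feasibility of [few_above]: its differences are nonnegative, and they
   are binomial coefficients below the threshold [c]. *)
Lemma card_small_fibres c N : (d <= N)%N ->
  (#|[set A : {set J} | (#|A| == N) && (#|E (cD A)| < c)%N]|%:R : R)
  <= few_above R c d N #|J|.
Proof.
move=> dN; rewrite -sum_fdiff_fibres -sum1dep_card natr_sum.
rewrite (partition_big cD [pred D | cD D == D]) /=; last first.
  move=> A _; have := cDP A (cD A); rewrite eqxx => /esym/and3P[/eqP e _ _].
  by rewrite e.
apply: ler_sum => D /eqP cDD; have Dd := card_cD cDD.
have DE := subset_leq_card (sub_cD cDD).
rewrite iter_fdiff_few_above ?(leq_trans Dd) //.
(* An interval with a large upper end is not counted on the left, and its term on the right is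
   nonnegative. *)
have [Ec|Ec] := boolP (#|E D| < c)%N; last first.
  rewrite big_pred0 ?few_above_ge0 // => A; apply/negbTE; apply: contra Ec.
  by case/andP => /andP[_ +] /eqP => /[swap] ->.
(* Here the argument lies below [c], so the term is exactly the number of [N]-subsets in the
   interval. *)
have -> : few_above R c (d - #|D|) (N - #|D|) (#|E D| - #|D|)%N
       = 'C(#|E D| - #|D|, N - #|D|)%:R.
  by rewrite /few_above (leq_ltn_trans (leq_subr _ _) Ec).
have := card_cD_fibre N cDD; rewrite (leq_trans Dd dN) => <-.
rewrite -sum1dep_card natr_sum le_eqVlt; apply/orP; left; apply/eqP.
apply: eq_bigl => A; rewrite -andbA; congr (_ && _).
by case: eqVneq => [->|]; rewrite ?andbT // andbF.
Qed.

End IntervalPartition.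

(** * Relaxed lexicographic programs *)

Section RelaxedProgram.
Variables (R : realType) (E : lmodType R) (J Rw : finType).
Variables (own : Rw -> option J) (g : Rw -> E -> R) (h : Rw -> R).
(* [better u] means that moving by [u] strictly improves the objective. *)
Variable better : E -> Prop.
Implicit Types (A B D : {set J}) (t : J -> R) (z u : E).

Hypothesis gD : forall r z z', g r (z + z') = g r z + g r z'.
Hypothesis gZ : forall r a z, g r (a *: z) = a * g r z.
Hypothesis betterD : forall u u', better u -> better u' -> better (u + u').
Hypothesis betterZ : forall a u, 0 < a -> better u -> better (a *: u).
Hypothesis better0 : ~ better 0.

Definition unrelaxed : J -> R := fun=> 0.
(** Rows without an owner are shared constraints, which are never relaxed and bind for every set of
    samples. *)
Definition relaxed t r := h r + oapp t 0 (own r).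
Definition in_rows A r := if own r is Some i then i \in A else true.
Definition feasible t A z := forall r, in_rows A r -> g r z <= relaxed t r.
Definition optimal t A z :=
  feasible t A z /\ forall z', feasible t A z' -> z' <> z -> better (z - z').
Definition lexopt t A := xget 0 [set z | optimal t A z]%classic.
Definition satisfied t i z := [forall r, (own r == Some i) ==> (g r z <= relaxed t r)].

Lemma optimal_unique t A z z' : optimal t A z -> optimal t A z' -> z = z'.
Proof.
move=> [fz oz] [fz' oz']; apply/eqP/negP => /negP/eqP zz'.
apply: better0; rewrite -(subrr z) -[X in X - _](addrNK z') -addrA.
by apply: betterD; [apply: oz => // /esym|apply: oz'].
Qed.

Lemma feasible_in_rows t t' A : {in A, t =1 t'} ->
  feasible t A = feasible t' A.
Proof.
move=> tt'; apply/funext => z; apply/propext; rewrite /feasible /relaxed /in_rows.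
split=> f r; have := f r; case: (own r) => [i|] //= h1 iA.
  by rewrite -tt' // h1.
by rewrite tt' // h1.
Qed.

Lemma lexopt_in t t' A : {in A, t =1 t'} -> lexopt t A = lexopt t' A.
Proof. by move=> tt'; rewrite /lexopt /optimal (feasible_in_rows tt'). Qed.

Lemma sub_feasible t A B z : B \subset A -> feasible t A z -> feasible t B z.
Proof.
move=> /fintype.subsetP BA f r; have := f r; rewrite /in_rows.
by case: (own r) => [i|] // h1 /BA.
Qed.

(** Only the rows that increase along [u] limit the step; each has positive slack, and the step is
    the least ratio of slack to slope, capped at 1. *)
Lemma feasible_step t A z u : feasible t A z ->
  (forall r, in_rows A r -> g r z < relaxed t r \/ g r u <= 0) ->
  exists2 e, 0 < e & feasible t A (z + e *: u).
Proof.
move=> fz hz.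
pose e r := if in_rows A r && (0 < g r u) then (relaxed t r - g r z) / g r u else 1.
have e0 : 0 < \big[Num.min/1]_r e r.
  apply: lt_bigmin => // r _.
  rewrite /e; case: ifP => // /andP[rA u0]; apply: divr_gt0 => //.
  by case: (hz r rA); rewrite ?subr_gt0 // leNgt u0.
exists (\big[Num.min/1]_r e r) => //.
move=> r rA; rewrite gD gZ -lerBrDl.
have [u0|u0] := ltP 0 (g r u); last first.
  apply: le_trans (_ : 0 <= _); last by rewrite subr_ge0 fz.
  exact: mulr_ge0_le0 (ltW e0) u0.
rewrite -ler_pdivlMr //; apply: le_trans (bigmin_le_cond _ _ (j := r) _) _ => //.
by rewrite /e rA u0.
Qed.

Hypothesis exopt : forall t A, (forall i, 0 <= t i) -> exists z, optimal t A z.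

Section FixedLabels.
Variable t : J -> R.
Hypothesis t0 : forall i, 0 <= t i.

Lemma lexoptP A : optimal t A (lexopt t A).
Proof. by have [z] := exopt A t0; apply: xgetI. Qed.

Lemma lexopt_feasible A : feasible t A (lexopt t A).
Proof. by case: (lexoptP A). Qed.

Lemma lexopt_not_better A z : feasible t A z -> ~ better (z - lexopt t A).
Proof.
move=> fz bz; have [fo oo] := lexoptP A.
have [ez|/eqP ne] := eqVneq z (lexopt t A).
  by move: bz; rewrite ez subrr; apply: better0.
apply: better0; rewrite -(subrr z) -[X in X - _](addrNK (lexopt t A)) -addrA.
by apply: betterD => //; apply: oo.
Qed.

Lemma lexopt_sub A B : B \subset A -> feasible t A (lexopt t B) ->
  lexopt t A = lexopt t B.
Proof.
move=> BA fA; apply: optimal_unique (lexoptP A) _; split => // z' fz'.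
by apply: (lexoptP B).2; apply: sub_feasible fz'.
Qed.

Lemma feasibleP A z :
  feasible t A z <-> feasible t finset.set0 z /\ {in A, forall i, satisfied t i z}.
Proof.
split=> [f|[f0 fA] r].
  split; first by apply: sub_feasible f; apply: finset.sub0set.
  move=> i iA; apply/forallP => r; apply/implyP => /eqP ri.
  by apply: f; rewrite /in_rows ri.
rewrite /in_rows; case ri: (own r) => [i|] iA.
  by have /forallP/(_ r) := fA i iA; rewrite ri eqxx.
by apply: f0; rewrite /in_rows ri.
Qed.

(** Bases in the sense of LP-type problems. Removing single elements suffices, since a subset with
    the same optimum forces it on all sets in between. *)
Definition irreducible B := [forall i in B, lexopt t (B :\ i) != lexopt t B].

Lemma ex_irreducible A :
  exists B, [/\ B \subset A, irreducible B & lexopt t B = lexopt t A].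
Proof.
have [n] := ubnP #|A|; elim: n A => // n IH A An.
have [iA|] := boolP (irreducible A); first by exists A.
rewrite /irreducible negb_forall_in => /exists_inP[i iA]; rewrite negbK => /eqP e.
have [|B [BA iB eB]] := IH (A :\ i).
  by rewrite (cardsD1 i) iA in An.
exists B; split=> //; first exact: fintype.subset_trans BA (finset.subsetDl _ _).
by rewrite eB.
Qed.

Definition basis A := xget finset.set0 [set B : {set J} |
  [/\ B \subset A, irreducible B & lexopt t B = lexopt t A]]%classic.

Lemma basisP A :
  [/\ basis A \subset A, irreducible (basis A) & lexopt t (basis A) = lexopt t A].
Proof. by have [B hB] := ex_irreducible A; rewrite /basis; case: xgetP => [_ ->|/(_ B)]. Qed.

Definition nonviolators A := [set i | satisfied t i (lexopt t A)].

(** Nondegeneracy: two irreducible sets with the same optimum would have the same nonviolators, so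
    that their intervals would overlap. *)
Definition generic := forall B B', irreducible B -> irreducible B' ->
  lexopt t B = lexopt t B' -> B = B'.

(** A set between [D] and its nonviolators has the optimum of [D], hence by genericity the same
    irreducible subset. Conversely, the optimum of [A] respects all of [A]. *)
Lemma basis_interval (gen : generic) A D :
  (basis A == D) =
  [&& basis D == D, D \subset A & A \subset nonviolators D].
Proof.
have nvD (B C : {set J}) : B \subset C -> lexopt t B = lexopt t C -> C \subset nonviolators B.
  move=> BC e; apply/fintype.subsetP => i iC; rewrite inE e.
  by have /feasibleP[_ ->] := @lexopt_feasible C.
apply/eqP/and3P => [<-|[/eqP bD DA AE]].
  have [bA iA eA] := basisP A; have [bB iB eB] := basisP (basis A).
  split=> //; last exact: nvD.
  by apply/eqP; apply: gen.
have [bA iA eA] := basisP A; have [_ iD _] := basisP D; rewrite bD in iD.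
apply: gen => //; rewrite eA; apply: lexopt_sub => //; apply/feasibleP; split.
  exact: (sub_feasible (finset.sub0set _) (@lexopt_feasible D)).
by move=> i iA'; have /fintype.subsetP/(_ i iA') := AE; rewrite inE.
Qed.

Lemma nonviolators_basis A : nonviolators (basis A) = nonviolators A.
Proof. by rewrite /nonviolators; have [_ _ ->] := basisP A. Qed.

Variable d : nat.
Hypothesis dim_le : forall (B : {set J}) (v : J -> E), (d < #|B|)%N ->
  exists c : J -> R, (exists2 i, i \in B & c i != 0) /\
    \sum_(i in B) c i *: v i = 0.

Lemma better_sum (P : pred J) (c : J -> R) (v : J -> E) i0 : P i0 ->
  (forall i, P i -> 0 < c i) -> (forall i, P i -> better (v i)) ->
  better (\sum_(i | P i) c i *: v i).
Proof.
move=> Pi0 c0 bv; rewrite (bigD1 i0) //=.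
pose Q u := u = 0 \/ better u.
have : Q (\sum_(i | P i && (i != i0)) c i *: v i).
  apply: (big_ind Q); [by left| |].
    move=> x y [->|bx] [->|by_]; rewrite /Q ?addr0 ?add0r; by [left|right|right; exact: betterD].
  by move=> i /andP[Pi _]; right; apply: betterZ; [apply: c0|apply: bv].
have b0 : better (c i0 *: v i0) by apply: betterZ; [apply: c0|apply: bv].
by case=> [->|b]; [rewrite addr0|apply: betterD].
Qed.

(* Radon's argument: if [B] were larger, then a linear dependence between the
   improving directions [lexopt (B :\ i) - lexopt B] would yield two convex
   combinations on the same improving ray, which together respect all the
   constraints of [B]. *)
Lemma card_irreducible B : irreducible B -> (#|B| <= d)%N.
Proof.
move=> iB; rewrite leqNgt; apply/negP => dB.
set z := lexopt t B; pose v i := lexopt t (B :\ i) - z.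
have bv i : i \in B -> better (v i).
  move=> iiB; apply: (lexoptP (B :\ i)).2.
    exact: (sub_feasible (finset.subsetDl _ _) (@lexopt_feasible B)).
  by move/eqP; rewrite eq_sym; apply/negP; have /forall_inP := iB; apply.
have [c [[i0 i0B ci0] c_sum]] := dim_le v dB.
pose P i := (i \in B) && (0 < c i); pose Q i := (i \in B) && (c i < 0).
pose u := \sum_(i | P i) c i *: v i.
have uQ : u = \sum_(i | Q i) (- c i) *: v i.
  apply/eqP; rewrite -subr_eq0 -sumrN /u; apply/eqP; rewrite -[RHS]c_sum.
  rewrite [RHS](bigID (fun i => 0 < c i)) /=; congr (_ + _).
  rewrite [RHS](bigID (fun i => c i == 0)) /= [X in _ = X + _]big1 ?add0r; last first.
    by move=> i /andP[_ /eqP ->]; rewrite scale0r.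
  apply: eq_big => [i|i _]; last by rewrite scaleNr opprK.
  by rewrite /Q -leNgt -andbA; congr (_ && _); rewrite lt_neqAle andbC.
have bu : better u.
  have [c0|c0] : 0 < c i0 \/ c i0 < 0.
    by have := lt_total ci0; case/orP; [right|left].
  - apply: (better_sum (i0 := i0)); rewrite ?/P ?i0B //.
      by move=> i /andP[].
    by move=> i /andP[] /bv.
  - rewrite uQ; apply: (better_sum (i0 := i0) (c := fun i => - c i)); rewrite ?/Q ?i0B //.
      by move=> i /andP[]; rewrite oppr_gt0.
    by move=> i /andP[] /bv.
pose a := \sum_(i | P i) c i; pose b := \sum_(i | Q i) - c i.
have a0 : 0 <= a by apply: sumr_ge0 => i /andP[_ /ltW].
have b0 : 0 <= b by apply: sumr_ge0 => i /andP[_]; rewrite oppr_ge0 => /ltW.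
(* The factor [e] brings the total weights of both combinations down to at most 1; the rest of the
   weight stays on [z]. *)
pose e := (1 + a + b)^-1.
have e0 : 0 < e by rewrite invr_gt0; lra.
have ea : e * a <= 1 by rewrite mulrC ler_pdivrMr ?mul1r //; lra.
have eb : e * b <= 1 by rewrite mulrC ler_pdivrMr ?mul1r //; lra.
have gz : feasible t B z := @lexopt_feasible B.
have key (S : pred J) (k : J -> R) r : in_rows B r ->
    e * \sum_(i | S i) k i <= 1 -> (forall i, S i -> 0 <= k i) ->
    (forall i, S i -> in_rows (B :\ i) r) ->
    g r (z + e *: \sum_(i | S i) k i *: v i) <= relaxed t r.
  move=> rB ek k0 rS; rewrite gD gZ.
  have -> : g r (\sum_(i | S i) k i *: v i) = \sum_(i | S i) k i * g r (v i).
    have g0 : g r 0 = 0 by rewrite -[X in g r X](scale0r (0 : E)) gZ mul0r.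
    rewrite (big_morph (g r) (gD r) g0).
    by apply: eq_bigr => i _; rewrite gZ.
  have : \sum_(i | S i) k i * g r (v i) <= \sum_(i | S i) k i * (relaxed t r - g r z).
    apply: ler_sum => i Si; apply: ler_wpM2l; first exact: k0.
    rewrite -lerBlDr opprK.
    have -> : g r (v i) + g r z = g r (lexopt t (B :\ i)) by rewrite -gD subrK.
    by apply: lexopt_feasible; apply: rS.
  rewrite -mulr_suml => le1.
  have w0 : 0 <= relaxed t r - g r z by rewrite subr_ge0 gz.
  have := ler_wpM2l (ltW e0) le1; have := ler_wpM2r w0 ek; rewrite mulrA; lra.
apply: (lexopt_not_better (A := B) (z := z + e *: u)); last first.
  by rewrite -/z addrAC subrr add0r; apply: betterZ.
move=> r rB; case ri: (own r) => [i|]; last first.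
  rewrite /u; apply: key => //; first by move=> j /andP[_ /ltW].
  by move=> j _; rewrite /in_rows ri.
have iB' : i \in B by move: rB; rewrite /in_rows ri.
(* Of the two expressions for [u], one in which [i] does not occur is used: every
   [lexopt t (B :\ j)] in it has [j != i] and so respects the rows of [i]. *)
have [Pi|Pi] := boolP (P i); last first.
  rewrite /u; apply: key => //; first by move=> j /andP[_ /ltW].
  move=> j Pj; rewrite /in_rows ri in_setD1 iB' andbT.
  by apply: contraNneq Pi => ->.
rewrite uQ; apply: key => //; first by move=> j /andP[_]; rewrite oppr_ge0 => /ltW.
move=> j /andP[_ cj]; rewrite /in_rows ri in_setD1 iB' andbT.
by apply: contraTneq Pi => ->; rewrite /P (lt_gtF cj) andbF.
Qed.

End FixedLabels.

(* Relaxing a single constraint [i] makes it inactive at the old optimum. *)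
Lemma degenerate_label_unique i B B' t t' : (forall j, 0 <= t j) -> (forall j, 0 <= t' j) ->
  (forall j, j != i -> t j = t' j) -> t i < t' i -> i \in B -> i \notin B' ->
  lexopt t B = lexopt t B' -> lexopt t' B = lexopt t' B' ->
  lexopt t' (B :\ i) = lexopt t' B.
Proof.
move=> t0 t0' tt' ti iB iB' e e'; apply/eqP/negP => /negP/eqP ne.
have ez : lexopt t' B = lexopt t B.
  rewrite e e'; apply/esym/lexopt_in => j jB'; apply: tt'.
  by apply: contraNneq iB' => <-.
set z := lexopt t' B in ne ez.
have fz' : feasible t' B z by exact: lexopt_feasible.
have fz : feasible t B z by rewrite ez; exact: lexopt_feasible.
have bu : better (lexopt t' (B :\ i) - z).
  apply: (lexoptP t0' (B :\ i)).2; last by move/esym.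
  exact: (sub_feasible (finset.subsetDl _ _) fz').
(* With the label [t' i] the rows of [i] have slack at [z], which respects them already with the
   smaller label [t i]. The other tight rows do not increase towards the optimum of [B :\ i], so a
   short step would improve on [z]. *)
have [|ep ep0 fe] := feasible_step (u := lexopt t' (B :\ i) - z) fz'; last first.
  by apply: (lexopt_not_better t0' fe); rewrite -/z addrAC subrr add0r; apply: betterZ.
move=> r rB; case: (eqVneq (own r) (Some i)) => [ri|ri].
  left; apply: le_lt_trans (fz r rB) _.
  by rewrite /relaxed ri /= ltrD2l.
have rBi : in_rows (B :\ i) r.
  move: rB ri; rewrite /in_rows; case: (own r) => // j jB ji.
  by rewrite in_setD1 jB andbT; apply: contra_neq ji => ->.
have := fz' r rB; rewrite le_eqVlt => /predU1P[ez'|]; last by left.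
right; rewrite -[X in X <= _](addrK (g r z)) -gD subrK ez' subr_le0.
exact: lexopt_feasible.
Qed.

(** A union bound over the triples of an index and two sets. With all labels but that of the index
    fixed, [degenerate_label_unique] leaves at most one of its labels bad for a triple, and there is
    one more label than there are triples. *)
Lemma ex_generic (s : R) : 0 < s ->
  exists k : {ffun J -> 'I_(#|{: J * {set J} * {set J}}|.+1)},
    generic (fun i => s * (k i)%:R).
Proof.
move=> s0; set K := (#|_|.+1); pose lab (k : {ffun J -> 'I_K}) i := s * (k i)%:R : R.
have lab0 k i : 0 <= lab k i by rewrite /lab mulr_ge0 ?ler0n ?ltW.
pose bad (x : J * {set J} * {set J}) (k : {ffun J -> 'I_K}) :=
  [&& x.1.1 \in x.1.2, x.1.1 \notin x.2, irreducible (lab k) x.1.2 &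
      lexopt (lab k) x.1.2 == lexopt (lab k) x.2].
have [k kP] : exists k, forall x, ~~ bad x k.
  apply/not_existsP => nk.
  pose Bad x := [set k | bad x k].
  have cB x : (#|Bad x| * K <= K ^ #|J|)%N.
    (* Overwriting the label of the index is injective on pairs of a bad labelling and a new value,
       so the bad labellings are at most a fraction [1 / K] of all. *)
    pose upd (kv : {ffun J -> 'I_K} * 'I_K) :=
      [ffun j => if j == x.1.1 then kv.2 else kv.1 j].
    have -> : (#|Bad x| * K = #|finset.setX (Bad x) [set: 'I_K]|)%N.
      by rewrite cardsX cardsT card_ord.
    rewrite -(card_in_imset (f := upd)); last first.
      move=> [k v] [k' v']; rewrite !inE !andbT /= => bk bk' /ffunP ek.
      have ev : v = v' by have := ek x.1.1; rewrite !ffunE eqxx.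
      rewrite ev; congr (_, _).
      have kk' j : j != x.1.1 -> k j = k' j.
        by move=> ji; have := ek j; rewrite !ffunE (negbTE ji).
      have clash (q q' : {ffun J -> 'I_K}) : bad x q -> bad x q' ->
          (forall j, j != x.1.1 -> q j = q' j) -> ~~ (q x.1.1 < q' x.1.1)%N.
        move=> /and4P[iB iB' _ /eqP e] /and4P[_ _ /forall_inP ir /eqP e'] qq'.
        apply/negP => lt; have /negP := ir _ iB; apply; apply/eqP.
        apply: (degenerate_label_unique (t := lab q) (B' := x.2)) => //.
          by move=> j ji; rewrite /lab qq'.
        by rewrite /lab ltr_pM2l // ltr_nat.
      apply/ffunP => j; have [->|/kk' //] := eqVneq j x.1.1.
      have c1 := clash k k' bk bk' kk'.
      have c2 := clash k' k bk' bk (fun i ji => esym (kk' i ji)).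
      by apply/val_inj/eqP; rewrite eqn_leq leqNgt c2 leqNgt c1.
    by rewrite (leq_trans (max_card _)) // card_ffun card_ord.
  have : (#|{: {ffun J -> 'I_K}}| <= \sum_x #|Bad x|)%N.
    apply: leq_trans (_ : #|\bigcup_x Bad x| <= _)%N; last first.
      elim/big_ind2 : _ => [|X a Y b Xa Yb|//]; first by rewrite cards0.
      exact: leq_trans (leq_card_setU _ _) (leq_add Xa Yb).
    rewrite -cardsT; apply: subset_leq_card; apply/fintype.subsetP => k _.
    have := nk k; move/existsNP => [x /negP]; rewrite negbK => bx.
    by apply/finset.bigcupP; exists x => //; rewrite inE.
  rewrite card_ffun card_ord leqNgt => /negP; apply.
  have : (\sum_x #|Bad x| * K <= \sum_(x : J * {set J} * {set J}) K ^ #|J|)%N.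
    by apply: leq_sum => x _.
  rewrite sum_nat_const -big_distrl /= => le.
  rewrite -(ltn_pmul2r (m := K)) // (leq_ltn_trans le) // mulnC ltn_pmul2l ?expn_gt0 //.
(* Two distinct irreducible sets with the same optimum differ in an element of one of them, which
   gives a bad triple. *)
exists k => B B' iB iB' e.
apply/eqP; rewrite finset.eqEsubset; apply/andP; split; apply/fintype.subsetP => i ii.
  apply/negP => /negP ni; have := kP (i, B, B').
  by rewrite /bad /= ii ni iB e eqxx.
apply/negP => /negP ni; have := kP (i, B', B).
by rewrite /bad /= ii ni iB' e eqxx.
Qed.

Variable d : nat.
Hypothesis dim_le : forall (B : {set J}) (v : J -> E), (d < #|B|)%N ->
  exists c : J -> R, (exists2 i, i \in B & c i != 0) /\
    \sum_(i in B) c i *: v i = 0.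
Hypothesis violation_stable : forall A j, ~~ satisfied unrelaxed j (lexopt unrelaxed A) ->
  exists2 e : R, 0 < e & forall t, (forall i, 0 <= t i <= e) ->
    ~~ satisfied t j (lexopt t A).

(** Only finitely many pairs of a set and an index are involved, so one bound [e] on the labels
    preserves all violations, and generic multiples of [e / K] respect it. A set violated by at
    least [th] indices has at most [#|J| - th] nonviolators; the successor makes the threshold
    strict. *)
Lemma card_many_violated N th : (d <= N)%N -> (0 < th)%N ->
  (#|[set A : {set J} | (#|A| == N) &&
        (th <= #|[set j | ~~ satisfied unrelaxed j (lexopt unrelaxed A)]|)%N]|%:R : R)
  <= few_above R (#|J| - th).+1 d N #|J|.
Proof.
move=> dN th0.
pose viol (x : {set J} * J) := ~~ satisfied unrelaxed x.2 (lexopt unrelaxed x.1).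
have /choice[ee eeP] : forall x : {set J} * J, exists e : R, 0 < e /\
    (viol x -> forall t, (forall i, 0 <= t i <= e) -> ~~ satisfied t x.2 (lexopt t x.1)).
  move=> x; have [vx|_] := boolP (viol x); last by exists 1.
  by have [e e0 eP] := violation_stable vx; exists e.
pose e := \big[Num.min/1]_x ee x.
have e0 : 0 < e.
  by apply: lt_bigmin => // x _; have [] := eeP x.
set K := (#|{: J * {set J} * {set J}}|.+1).
have [|k gk] := @ex_generic (e / K%:R); first by rewrite divr_gt0.
set t := (fun i => _) in gk.
have t0 i : 0 <= t i by rewrite /t mulr_ge0 // ltW // divr_gt0.
have te i : t i <= e.
  rewrite /t -mulrA -[leRHS]mulr1 ler_pM2l // mulrC ler_pdivrMr // mul1r ler_nat.
  exact/ltnW/ltn_ord.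
have vt A j : ~~ satisfied unrelaxed j (lexopt unrelaxed A) -> ~~ satisfied t j (lexopt t A).
  move=> v; have [_ /(_ v)] := eeP (A, j); apply=> i; rewrite t0 /=.
  by apply: le_trans (te i) _; apply: bigmin_le_cond.
apply: le_trans (@card_small_fibres R J d (nonviolators t) (basis t) _ _ _ N dN).
- rewrite ler_nat; apply: subset_leq_card; apply/fintype.subsetP => A; rewrite !inE.
  case/andP => -> thA /=; rewrite nonviolators_basis // ltnS.
  have : (#|[set j | ~~ satisfied unrelaxed j (lexopt unrelaxed A)]| <= #|~: nonviolators t A|)%N.
    by apply: subset_leq_card; apply/fintype.subsetP => j; rewrite !inE; apply: vt.
  move/(leq_trans thA); rewrite -(cardsC (nonviolators t A)) => le.
  by rewrite -addnBA ?leq_addr.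
- by move=> A D; rewrite basis_interval.
- move=> D eD.
  have [_ iD _] := basisP t D; rewrite eD in iD.
  exact: (@card_irreducible t t0 d dim_le D iD).
Qed.

End RelaxedProgram.

(** * The Chernoff bound *)

Section Chernoff.
Variable R : realType.

Lemma ffact_leq n k : (n ^_ k <= n ^ k)%N.
Proof.
elim: k n => [|k IH] n //; rewrite ffactnS expnS leq_mul2l; apply/orP; right.
by apply: leq_trans (IH _) _; case: k {IH} => // k; rewrite leq_exp2r ?leq_pred.
Qed.

Lemma leq_ffact n k : ((n - k) ^ k <= n ^_ k)%N.
Proof.
elim: k n => [|k IH] n //; rewrite ffactnS expnS leq_mul ?leq_subr //.
by apply: leq_trans (IH _); case: k {IH} => // k; rewrite leq_exp2r //; lia.
Qed.

Lemma bin_le_exp (n k : nat) : 'C(n, k)%:R <= n%:R ^+ k / k`!%:R :> R.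
Proof.
rewrite ler_pdivlMr ?ltr0n ?fact_gt0 // -natrM bin_ffact -natrX ler_nat.
exact: ffact_leq.
Qed.

(** The terms have [i <= d], so each may be multiplied by [a ^+ (d - i) >= 1]. Bounding ['C(n, k)]
    by [n ^ k / k!] and letting the sum run up to [N] then gives a binomial expansion. *)
Lemma few_above_le (a : R) (c d N x : nat) : 1 <= a -> (c <= x)%N -> (d <= N)%N ->
  few_above R c d.+1 N x <= a ^+ d * (c%:R + (x - c)%:R / a) ^+ N / N`!%:R.
Proof.
move=> a1 cx dN; have a0 : 0 < a by apply: lt_le_trans a1.
rewrite /few_above ltnNge cx /= exprDn mulr_sumr mulr_suml.
rewrite (big_ord_widen N.+1 (fun i => ('C(x - c, i) * 'C(c, N - i))%:R)) //.
rewrite big_mkcond; apply: ler_sum => i _; have iN : (i <= N)%N by rewrite -ltnS.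
have rhs0 (j : nat) : 0 <= a ^+ d * (c%:R ^+ (N - j) * ((x - c)%:R / a) ^+ j *+ 'C(N, j)) / N`!%:R.
  rewrite divr_ge0 // mulr_ge0 ?exprn_ge0 ?(ltW a0) // mulrn_wge0 // mulr_ge0 ?exprn_ge0 //.
  by rewrite divr_ge0 // ltW.
case: ifP => // id; rewrite ltnS in id.
rewrite natrM; apply: le_trans (ler_pM _ _ (bin_le_exp _ _) (bin_le_exp _ _)) _ => //.
have fN : N`!%:R = 'C(N, i)%:R * (i`!%:R * (N - i)`!%:R) :> R.
  by rewrite -!natrM bin_fact.
have bin0' : 'C(N, i)%:R != 0 :> R by rewrite pnatr_eq0 -lt0n bin_gt0.
have f0 k : k`!%:R != 0 :> R by rewrite pnatr_eq0 -lt0n fact_gt0.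
have -> : a ^+ d * (c%:R ^+ (N - i) * ((x - c)%:R / a) ^+ i *+ 'C(N, i)) / N`!%:R =
   a ^+ (d - i) * ((x - c)%:R ^+ i / i`!%:R * (c%:R ^+ (N - i) / (N - i)`!%:R)).
  rewrite fN expr_div_n -{1}(subnK id) exprD -mulr_natr.
  by field; rewrite !f0 bin0' expf_neq0 ?gt_eqF.
rewrite ler_peMl ?exprn_ege1 // mulr_ge0 // divr_ge0 // exprn_ge0 //.
Qed.

(** The Chernoff parameter is Euler's number [expR 1], while [e] is a violation level. In the error
    [N.+1 / n], the part [N] comes from the [N] samples added to [n] and the part 1 from rounding
    [e * n] down; it vanishes as [n] grows. *)
Lemma few_above_expR (d N n : nat) (e : R) :
  (d <= N)%N -> (0 < N)%N -> (0 < n)%N -> 0 <= e <= 1 ->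
  few_above R (N + n - (Num.truncn (e * n%:R)).+1).+1 d.+1 N (N + n) <=
  expR (d%:R - N%:R * (e * (1 - (expR 1)^-1)) + N%:R * N.+1%:R / n%:R) * 'C(N + n, N)%:R.
Proof.
move=> dN N0 n0 /andP[e0 e1]; set L := Num.truncn _.
have a1 : 1 <= expR 1 :> R by rewrite -[leLHS]expR0 ler_expR.
have a0 : 0 < expR 1 :> R by exact: expR_gt0.
have nR : 0 < n%:R :> R by rewrite ltr0n.
have en0 : 0 <= e * n%:R by rewrite mulr_ge0 // ltW.
have /andP[Ll Lu] : L%:R <= e * n%:R < L.+1%:R := truncn_itv en0.
have Ln : (L <= n)%N.
  by rewrite -(ler_nat R); apply: le_trans Ll _; rewrite ler_piMl // ltW.
have -> : (N + n - L.+1).+1 = (N + n - L)%N by lia.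
apply: le_trans (few_above_le a1 (leq_subr _ _) dN) _.
have -> : (N + n - (N + n - L))%N = L by lia.
set k := 1 - (expR 1)^-1.
have k01 : 0 <= k <= 1.
  by rewrite /k subr_ge0 invf_le1 // a1 /= gerBl invr_ge0 ltW.
have base : (N + n - L)%:R + L%:R / expR 1 <= n%:R * expR (- (e * k) + N.+1%:R / n%:R) :> R.
  apply: le_trans (_ : _ <= n%:R * (1 + (- (e * k) + N.+1%:R / n%:R))) _; last first.
    by rewrite ler_pM2l // expR_ge1Dx.
  have -> : n%:R * (1 + (- (e * k) + N.+1%:R / n%:R)) = n%:R - e * n%:R * k + N.+1%:R.
    by field; rewrite gt_eqF.
  rewrite natrB ?natrD; last by lia.
  have -> : L%:R / expR 1 = L%:R - L%:R * k by rewrite /k; ring.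
  rewrite -[L.+1%:R]natr1 in Lu; rewrite -[N.+1%:R]natr1; nra.
have b0 : 0 <= (N + n - L)%:R + L%:R / expR 1 :> R.
  by rewrite addr_ge0 // divr_ge0 // ltW.
apply: le_trans (_ : _ <= expR 1 ^+ d * (n%:R * expR (- (e * k) + N.+1%:R / n%:R)) ^+ N / N`!%:R) _.
  rewrite ler_pM2r ?invr_gt0 ?ltr0n ?fact_gt0 // ler_pM2l ?exprn_gt0 //.
  by rewrite lerXn2r ?nnegrE // (le_trans b0).
have -> : expR (d%:R - N%:R * (e * k) + N%:R * N.+1%:R / n%:R) =
    expR 1 ^+ d * expR (- (e * k) + N.+1%:R / n%:R) ^+ N.
  by rewrite -!expRM_natr -expRD; congr expR; ring.
rewrite exprMn [n%:R ^+ N * _]mulrC !mulrA -mulrA ler_pM2l ?mulr_gt0 ?exprn_gt0 ?expR_gt0 //.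
rewrite ler_pdivrMr ?ltr0n ?fact_gt0 // -natrM bin_ffact -natrX ler_nat.
by rewrite -[X in (X ^ N <= _)%N](addKn N n); exact: leq_ffact.
Qed.

(** The factor [expR 1 / (expR 1 - 1)] is the inverse of [1 - (expR 1)^-1], so the sample size is
    exactly what brings the exponent down to [ln gamma]. *)
Lemma sample_size_bound (d N : nat) (eps gamma : R) : 0 < eps -> 0 < gamma ->
  eps^-1 * (expR 1 / (expR 1 - 1)) * (ln gamma^-1 + d%:R) <= N%:R ->
  expR (d%:R - N%:R * (eps * (1 - (expR 1)^-1))) <= gamma.
Proof.
move=> e0 g0 hN.
have a1 : 1 < expR 1 :> R by rewrite expR_gt1.
have a0 : 0 < expR 1 :> R by exact: expR_gt0.
rewrite -[leRHS]lnK ?posrE // ler_expR.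
have -> : ln gamma = - ln gamma^-1 by rewrite lnV ?posrE // opprK.
rewrite lerBlDr addrC -lerBlDr opprK addrC.
have k0 : 0 < eps * (1 - (expR 1)^-1).
  by rewrite mulr_gt0 // subr_gt0 invf_lt1.
rewrite -ler_pdivrMr //; apply: le_trans hN.
rewrite le_eqVlt; apply/orP; left; apply/eqP; field.
by rewrite !gt_eqF ?subr_gt0.
Qed.

(** The factors in front are at least 1 and [ln gamma^-1] is positive. With [d = nx] this makes [N]
    at least the dimension [nx.+1] of the program. *)
Lemma sample_size_gt (d N : nat) (eps gamma : R) : 0 < eps < 1 -> 0 < gamma < 1 ->
  eps^-1 * (expR 1 / (expR 1 - 1)) * (ln gamma^-1 + d%:R) <= N%:R -> (d < N)%N.
Proof.
move=> /andP[e0 e1] /andP[g0 g1] hN.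
have a1 : 1 < expR 1 :> R by rewrite expR_gt1.
have lg : 0 < ln gamma^-1 by rewrite ln_gt0 // invf_gt1.
rewrite -(ltr_nat R); apply: lt_le_trans hN.
have e1' : 1 <= eps^-1 by rewrite invf_ge1 // ltW.
have b1 : 1 <= expR 1 / (expR 1 - 1) :> R by rewrite ler_pdivlMr ?mul1r ?gerBl // subr_gt0.
have c1 : 1 <= eps^-1 * (expR 1 / (expR 1 - 1)) by exact: mulr_ege1.
apply: lt_le_trans (_ : ln gamma^-1 + d%:R <= _); first by rewrite ltrDr.
by rewrite ler_peMl // addr_ge0 // ltW.
Qed.

End Chernoff.

Local Open Scope classical_set_scope.
Local Open Scope ring_scope.

(** * Stability under relaxation *)

(** The functions are maximised in turn, each over the compact set on which its predecessors keep
    the values already attained. *)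
Lemma compact_lexmax (R : realType) (X : topologicalType) (f : nat -> X -> R)
    (K : set X) n :
  K !=set0 -> compact K -> (forall k, continuous (f k)) -> closed K ->
  exists2 z, K z & forall z', K z' ->
    (exists2 i, (i < n)%N & f i z' < f i z /\ forall j, (j < i)%N -> f j z' = f j z) \/
    (forall i, (i < n)%N -> f i z' = f i z).
Proof.
move=> [x Kx] cK cf clK; elim: n => [|n [z Kz zP]]; first by exists x => // z' _; right.
pose K' := K `&` [set z' | forall i, (i < n)%N -> f i z' = f i z].
have clK' : closed K'.
  apply: closedI => //.
  have -> : [set z' | forall i, (i < n)%N -> f i z' = f i z] =
      \bigcap_(i in `I_n) (f i @^-1` [set f i z]) by [].
  apply: closed_bigI => i _; apply: closed_comp; last exact: closed_eq.
  by move=> ? _; exact: cf.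
have cK' : compact K' by apply: subclosed_compact cK _ => // y [].
have K'0 : K' !=set0 by exists z.
have [|z1 /set_mem[Kz1 ez1] z1P] := @compact_EVT_max _ _ (f n) K' K'0 cK'.
  by apply: continuous_subspaceT; exact: cf.
exists z1 => // z' Kz'; have [[i lin [lt eq]]|eq] := zP z' Kz'.
  left; exists i; first exact: ltnW.
  by rewrite ez1 //; split=> // j ji; rewrite ez1 ?eq // (ltn_trans ji).
have := z1P z'; rewrite inE => /(_ (conj Kz' eq)); rewrite le_eqVlt => /predU1P[e|lt].
  right=> i; rewrite ltnS leq_eqVlt => /predU1P[->//|lin].
  by rewrite eq // ez1.
by left; exists n => //; split=> // j jn; rewrite eq // ez1.
Qed.

Section Stability.
Variables (R : realType) (E : normedModType R) (J Rw : finType).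
Variables (own : Rw -> option J) (g : Rw -> E -> R) (h : Rw -> R).
Variable better : E -> Prop.
Hypothesis gD : forall r z z', g r (z + z') = g r z + g r z'.
Hypothesis gZ : forall r a z, g r (a *: z) = a * g r z.
Hypothesis betterD : forall u u', better u -> better u' -> better (u + u').
Hypothesis betterZ : forall a u, 0 < a -> better u -> better (a *: u).
Hypothesis better0 : ~ better 0.
Hypothesis exopt : forall t A, (forall i, 0 <= t i) ->
  exists z, optimal own g h better t A z.
Hypothesis cg : forall r, continuous (g r).
Hypothesis cK : compact [set z | feasible own g h (@unrelaxed R J) finset.set0 z].

(** Otherwise there are labels tending to 0 whose optima [zn] respect [j]. The shared rows confine
    the [zn] to a compact set, and a cluster point [z0] respects the unrelaxed rows of [A] and of
    [j]. The unrelaxed optimum [zs] violates [j], hence differs from [z0] and is better. *)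
Lemma violation_stable A j :
  let o := lexopt own g h better in
  ~~ satisfied own g h (@unrelaxed R J) j (o (@unrelaxed R J) A) ->
  exists2 e : R, 0 < e & forall t, (forall i, 0 <= t i <= e) ->
    ~~ satisfied own g h t j (o t A).
Proof.
move=> o vj; apply: contrapT => nstab.
have /choice[tn tnP] n : exists t : J -> R, (forall i, 0 <= t i <= n.+1%:R^-1) /\
    satisfied own g h t j (o t A).
  apply: contrapT => nt; apply: nstab; exists n.+1%:R^-1; first by rewrite invr_gt0.
  by move=> t tP; apply/negP => st; apply: nt; exists t.
have t0 n i : 0 <= tn n i by have [/(_ i)/andP[]] := tnP n.
pose zn n := o (tn n) A.
have fzn n r : in_rows own A r \/ own r = Some j -> g r (zn n) <= relaxed own h (tn n) r.
  case=> [rA|rj]; first exact: lexopt_feasible.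
  by have [_ /forallP/(_ r)] := tnP n; rewrite rj eqxx.
have [z0 [fz0 clz0]] : [set z | feasible own g h (@unrelaxed R J) finset.set0 z] `&`
    cluster (zn @ \oo) !=set0.
  apply: cK; exists 0%N => // n _ r r0.
  have := fzn n r; move: r0; rewrite /relaxed /in_rows.
  by case: (own r) => [i|_] /=; [rewrite finset.inE|apply; left].
have zn_near (U : set E) (m : nat) : nbhs z0 U -> exists2 n, (m <= n)%N & U (zn n).
  move=> nU; have [_ [[n mn <-] Uzn]] : [set zn n | n in [set n | (m <= n)%N]] `&` U !=set0.
    by apply: clz0 => //; exists m => // n mn; exists n.
  by exists n.
have hz0 r : in_rows own A r \/ own r = Some j -> g r z0 <= h r.
  move=> rP; rewrite leNgt; apply/negP => lt.
  pose e : R := (g r z0 - h r) / 2; have e0 : 0 < e by rewrite divr_gt0 // subr_gt0.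
  have nU : nbhs z0 [set z | h r + e < g r z].
    by have /cvgr_gt := @cg r z0; apply; rewrite /e; lra.
  pose m := Num.truncn e^-1.
  have [n mn] := zn_near _ m nU; rewrite /=; apply/negP; rewrite -leNgt.
  apply: le_trans (fzn n r rP) _; rewrite /relaxed lerD2l.
  case: (own r) => [i|] /=; last exact: ltW.
  have [/(_ i)/andP[_ le] _] := tnP n; apply: le_trans le _.
  rewrite invf_ple ?posrE //; apply: ltW; apply: lt_le_trans (_ : m.+1%:R <= _).
    by rewrite /m real_truncnS_gt ?num_real.
  by rewrite ler_nat.
pose zs := o (@unrelaxed R J) A.
have fz0A : feasible own g h (@unrelaxed R J) A z0.
  move=> r rA; apply: le_trans (hz0 r (or_introl rA)) _.
  by rewrite /relaxed /unrelaxed; case: (own r) => [i|] /=; rewrite addr0.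
have u0 i : 0 <= @unrelaxed R J i by rewrite /unrelaxed.
have bv : better (zs - z0).
  apply: (lexoptP exopt u0 A).2 => // e; move: vj => /negP; apply.
  have -> : o (@unrelaxed R J) A = z0 by rewrite e.
  apply/forallP => r; apply/implyP => /eqP rj.
  by rewrite (le_trans (hz0 r (or_intror rj))) // /relaxed rj /= addr0.
pose U := [set z | forall r, g r z0 < h r -> g r z < h r].
have nU : nbhs z0 U.
  apply: filter_forall => r; have [lt|_] := ltP (g r z0) (h r); last exact: nearW.
  have : nbhs z0 [set z | g r z < h r].
    by have /cvgr_lt := @cg r z0; apply.
  by apply: filterS.
have [n _ Un] := zn_near U 0%N nU.
have fn : feasible own g h (tn n) A (zn n) by move=> r rA; apply: fzn; left.
(* A short step from [zn n] along [zs - z0] would improve it. Rows tight at [z0] do not increase in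
   this direction, and the others have slack at [zn n], which is close to [z0]. *)
have [|e e0 fe] := feasible_step gD gZ (u := zs - z0) fn; last first.
  apply: (lexopt_not_better betterD better0 exopt (t0 n) fe).
  by rewrite -/(o (tn n) A) -/(zn n) addrAC subrr add0r; apply: betterZ.
move=> r rA.
have hr : h r <= relaxed own h (tn n) r.
  by rewrite /relaxed lerDl; case: (own r) => [i|] //=.
have := hz0 r (or_introl rA); rewrite le_eqVlt => /predU1P[e|lt].
  right; rewrite -[X in X <= _](addrK (g r z0)) -gD subrK e subr_le0.
  apply: le_trans (lexopt_feasible exopt u0 rA) _.
  by rewrite /relaxed; case: (own r) => [i|] /=; rewrite ?addr0.
by left; apply: lt_le_trans hr; apply: Un.
Qed.

End Stability.

(** * The scenario linear program *)

Section LexOrder.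
Variable R : realType.

Lemma lex_ltD m (u v : 'cV[R]_m) : lex_lt u 0 -> lex_lt v 0 -> lex_lt (u + v) 0.
Proof.
move=> [i [ui ei]] [k [vk ek]].
have [ik|ki|/val_inj ik] := ltngtP i k.
- exists i; split => [|j ji]; rewrite mxE.
    by rewrite (ek _ ik) !mxE addr0; move: ui; rewrite mxE.
  by rewrite ei // ek ?(ltn_trans ji) // !mxE addr0.
- exists k; split => [|j jk]; rewrite mxE.
    by rewrite (ei _ ki) !mxE add0r; move: vk; rewrite mxE.
  by rewrite ek // ei ?(ltn_trans jk) // !mxE addr0.
- subst k; exists i; split => [|j ji]; rewrite mxE.
    by have := ltrD ui vk; rewrite !mxE addr0.
  by rewrite ei // ek // !mxE addr0.
Qed.

Lemma lex_ltZ m (a : R) (u : 'cV[R]_m) : 0 < a -> lex_lt u 0 -> lex_lt (a *: u) 0.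
Proof.
move=> a0 [i [ui ei]]; exists i; split => [|j ji].
  by move: ui; rewrite !mxE pmulr_rlt0.
by rewrite mxE ei // !mxE mulr0.
Qed.

Lemma lex_lt_irr m (u : 'cV[R]_m) : ~ lex_lt u u.
Proof. by move=> [i [+ _]]; rewrite ltxx. Qed.

Lemma lex_lt_subr m (u v : 'cV[R]_m) : lex_lt u v <-> lex_lt (u - v) 0.
Proof.
split=> -[i [ui ei]]; exists i; split => [|j ji].
- by rewrite !mxE subr_lt0.
- by rewrite !mxE ei // subrr.
- by move: ui; rewrite !mxE subr_lt0.
- by apply/eqP; rewrite -subr_eq0; apply/eqP; have := ei j ji; rewrite !mxE.
Qed.

Lemma lex_lt_col_mx m n (u v : 'cV[R]_m) (u' v' : 'cV[R]_n) :
  lex_lt u v -> lex_lt (col_mx u u') (col_mx v v').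
Proof.
move=> [i [ui ei]]; exists (lshift n i); rewrite !col_mxEu; split => // j ji.
have jm : (j < m)%N by apply: ltn_trans ji (ltn_ord i).
have -> : j = lshift n (Ordinal jm) by apply: val_inj.
by rewrite !col_mxEu ei.
Qed.

Lemma mulmx_coord_continuous m n (M : 'M[R]_(m, n)) i :
  continuous (fun y : 'cV[R]_n => (M *m y) i 0).
Proof.
rewrite (_ : (fun _ => _) = (fun y : 'cV[R]_n => \sum_j M i j * y j 0)).
  apply: (@continuous_big _ _ _ 0); first exact: (@add_continuous R^o).
  move=> j _ y.
  apply: (@continuous_comp _ _ _ (fun y : 'cV[R]_n => y j 0) (fun x => M i j * x)).
    exact: coord_continuous.
  exact: mulrl_continuous.
by apply/funext => x; rewrite mxE.
Qed.

End LexOrder.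

(** * Compact polytopes and the quantified set *)

Section Polytope.
Variables (R : realType) (nv nx : nat) (V : 'M[R]_(nv, nx)).
Hypothesis cV : compact (polytope V).

Lemma polytope0 : polytope V 0.
Proof. by move=> i; rewrite mulmx0 !mxE. Qed.

(** A nonzero [u] would span a ray from the origin inside the polytope, and a long enough multiple
    has a coordinate exceeding in modulus the maximum over the compact set. *)
Lemma polytope_recession (u : 'cV[R]_nx) : vle (V *m u) 0 -> u = 0.
Proof.
move=> Vu; apply/matrixP => i j; rewrite ord1 mxE; apply/eqP/negP => /negP ui.
have [|c _ cmax] := @compact_EVT_max _ _ (fun y : 'cV[R]_nx => `|y i 0|) _
    (ex_intro _ _ polytope0) cV.
  apply: continuous_subspaceT => y; apply: continuous_comp.
    exact: coord_continuous.
  exact: norm_continuous.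
pose a := (`|c i 0| + 1) / `|u i 0|.
have a0 : 0 < a by apply: divr_gt0; [apply: ltr_wpDl|rewrite normr_gt0].
have aW : polytope V (a *: u).
  move=> r; rewrite -scalemxAr mxE [leRHS]mxE.
  apply: le_trans (_ : 0 <= _) => //; apply: mulr_ge0_le0; first exact: ltW.
  by have := Vu r; rewrite [X in _ <= X]mxE.
have := cmax _ (mem_set aW).
rewrite mxE normrM (gtr0_norm a0) /a divfK ?normr_eq0 //; apply/negP.
by rewrite -ltNge ltrDl.
Qed.

(** Turns membership into finitely many linear inequalities, for all values of [z.2]. Above 1 the
    scale factor is negative and the inequalities are reversed; at 1 the set is a point, and
    compactness shows that the inequalities leave no other. *)
Lemma quantified_setE (z : 'cV[R]_nx * R) w :
  quantified_set V z w <->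
  let y := if 0 < z.2 then z.1 else 0 in
  if z.2 <= 1 then forall r, (V *m w) r 0 - (V *m y) r 0 <= 1 - z.2
  else forall r, 1 - z.2 <= (V *m w) r 0 - (V *m y) r 0.
Proof.
set y := if _ then _ else _ => /=.
have vy : (1 - (1 - z.2)) *: (if 0 < z.2 then z.2^-1 *: z.1 else 0) = y.
  rewrite /y; case: ifP => z0; last by rewrite scaler0.
  by rewrite subKr scalerA mulfV ?scale1r // gt_eqF.
have VB r : (V *m w) r 0 - (V *m y) r 0 = (V *m (w - y)) r 0.
  by rewrite mulmxBr !mxE.
have -> : quantified_set V z w <->
    exists2 w', polytope V w' & w - y = (1 - z.2) *: w'.
  rewrite /quantified_set /scaled_set /= vy; split=> -[w' Ww' e]; exists w' => //.
    by rewrite -e addrC addKr.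
  by rewrite -e addrC subrK.
have [z1|z1|z1] := ltgtP z.2 1.
- have b0 : 0 < 1 - z.2 by rewrite subr_gt0.
  split=> [[w' Ww' e] r|le].
    rewrite VB e -scalemxAr mxE ger_pMr //.
    by have := Ww' r; rewrite [X in _ <= X]mxE.
  exists ((1 - z.2)^-1 *: (w - y)); last by rewrite scalerA mulfV ?scale1r // gt_eqF.
  by move=> r; rewrite -scalemxAr mxE [leRHS]mxE -VB mulrC ler_pdivrMr // mul1r.
- have b0 : 1 - z.2 < 0 by rewrite subr_lt0.
  split=> [[w' Ww' e] r|le].
    rewrite VB e -scalemxAr mxE ler_nMr //.
    by have := Ww' r; rewrite [X in _ <= X]mxE.
  exists ((1 - z.2)^-1 *: (w - y)); last by rewrite scalerA mulfV ?scale1r // lt_eqF.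
  by move=> r; rewrite -scalemxAr mxE [leRHS]mxE -VB mulrC ler_ndivrMr // mul1r.
- rewrite z1 subrr; split=> [[w' _ e] r|le].
    by rewrite VB e scale0r mulmx0 mxE.
  exists 0; first exact: polytope0.
  by rewrite scaler0; apply: polytope_recession => r; rewrite -VB [leRHS]mxE.
Qed.

End Polytope.

(** * The linear program with rows owned by samples *)

Section ScenarioProgram.
Variables (R : realType) (nv nx : nat) (V : 'M[R]_(nv, nx)) (J : finType).
Variable p : J -> 'cV[R]_nx.
Hypothesis cV : compact (polytope V).
Hypothesis pV : forall j, polytope V (p j).
Local Notation E := ('cV[R]_nx * R)%type.

(** In order: the [nv] constraints of each sample, the constraints [V y <= beta], and the two bounds
    on [beta], where [true] stands for [beta <= 1]. *)
Definition lp_row : finType := (J * 'I_nv + ('I_nv + bool))%type.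
Definition row_owner (r : lp_row) : option J :=
  if r is inl (j, _) then Some j else None.
Definition row_lhs (r : lp_row) (z : E) : R :=
  match r with
  | inl (_, i) => z.2 - (V *m z.1) i 0
  | inr (inl i) => (V *m z.1) i 0 - z.2
  | inr (inr b) => if b then z.2 else - z.2
  end.
Definition row_rhs (r : lp_row) : R :=
  match r with
  | inl (j, i) => 1 - (V *m p j) i 0
  | inr (inl _) => 0
  | inr (inr b) => b%:R
  end.

Lemma row_lhsD r z z' : row_lhs r (z + z') = row_lhs r z + row_lhs r z'.
Proof.
by case: r => [[j i]|[i|[]]] /=; rewrite ?mulmxDr ?mxE //; ring.
Qed.

Lemma row_lhsZ r a z : row_lhs r (a *: z) = a * row_lhs r z.
Proof.
have e2 : (a *: z).2 = a * z.2 by [].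
have e1 i : (V *m (a *: z).1) i 0 = a * (V *m z.1) i 0 by rewrite -scalemxAr mxE.
by case: r => [[j i]|[i|[]]]; rewrite /row_lhs ?e1 e2; ring.
Qed.

Lemma snd_continuous : continuous (snd : E -> R).
Proof. by move=> z; apply: cvg_snd. Qed.

Lemma row_lhs_continuous r : continuous (row_lhs r).
Proof.
have cM i : continuous (fun z : E => (V *m z.1) i 0).
  move=> z; apply: (@continuous_comp _ _ _ fst (fun y => (V *m y) i 0)).
    exact: cvg_fst.
  exact: mulmx_coord_continuous.
case: r => [[j i]|[i|[]]] /= z.
- by apply: cvgB; [exact: snd_continuous|exact: cM].
- by apply: cvgB; [exact: cM|exact: snd_continuous].
- exact: snd_continuous.
- by apply: cvgN; exact: snd_continuous.
Qed.

Local Notation feas := (feasible row_owner row_lhs row_rhs).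

Lemma feasible_closed t A : closed [set z | feas t A z].
Proof.
have -> : [set z | feas t A z] =
  \bigcap_(r in [set r | in_rows row_owner A r])
    (row_lhs r @^-1` [set x | x <= relaxed row_owner row_rhs t r]) by [].
apply: closed_bigI => r _; apply: closed_comp; last exact: closed_le.
by move=> z _; exact: row_lhs_continuous.
Qed.

Lemma feasible0P t z :
  feas t finset.set0 z <-> vle (V *m z.1) (const_mx z.2) /\ 0 <= z.2 <= 1.
Proof.
split=> [f|[f /andP[z0 z1]]].
  split=> [i|].
    by rewrite [leRHS]mxE; have := f (inr (inl i)) isT; rewrite /relaxed /= addr0 subr_le0.
  have := f (inr (inr true)) isT; have := f (inr (inr false)) isT.
  by rewrite /relaxed /= !addr0 oppr_le0 => -> ->.
case=> [[j i]|[i|[]]]; rewrite /relaxed /in_rows /= ?addr0 ?oppr_le0 //.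
  by rewrite finset.inE.
by move=> _; rewrite subr_le0; have := f i; rewrite [X in _ <= X]mxE.
Qed.

Lemma feasible0_compact t : compact [set z | feas t finset.set0 z].
Proof.
have cVI : compact (polytope V `*` `[0, 1] : set E).
  by apply: compact_setX => //; exact: segment_compact.
apply: subclosed_compact (@feasible_closed t finset.set0) cVI _.
move=> z /feasible0P[f z01]; split; last by rewrite /= in_itv.
move=> i; apply: le_trans (f i) _; rewrite !mxE.
by case/andP: z01.
Qed.

Lemma feasible_compact t A : compact [set z | feas t A z].
Proof.
apply: subclosed_compact (@feasible0_compact t) _; first exact: feasible_closed.
by move=> z; apply: sub_feasible; exact: finset.sub0set.
Qed.

(** The point [y = 0], [beta = 0] stands for the whole polytope, which contains all samples. *)
Lemma feasible_origin t A : (forall i, 0 <= t i) -> feas t A 0.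
Proof.
move=> t0 r _; have -> : row_lhs r 0 = 0.
  by case: r => [[j i]|[i|[]]] /=; rewrite ?mulmx0 ?mxE ?subrr ?oppr0.
rewrite /relaxed; case: r => [[j i]|[i|[]]] /=; rewrite ?addr0 //.
by rewrite addr_ge0 // subr_ge0; have := pV j i; rewrite [X in _ <= X]mxE.
Qed.

Variables (m : nat) (T : 'M[R]_(m, nx)).
Hypothesis Tinj : forall y : 'cV[R]_nx, T *m y = 0 -> y = 0.

Definition improves (u : E) := 0 < u.2 \/ (u.2 = 0 /\ lex_lt (T *m u.1) 0).

Lemma improvesD u u' : improves u -> improves u' -> improves (u + u').
Proof.
case=> [u0|[e l]] [u'0|[e' l']]; rewrite /improves /= ?e ?e' ?addr0 ?add0r.
- by left; apply: addr_gt0.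
- by left.
- by left.
- by right; split=> //; rewrite mulmxDr; apply: lex_ltD.
Qed.

Lemma improvesZ a u : 0 < a -> improves u -> improves (a *: u).
Proof.
move=> a0 [u0|[e l]]; [left|right]; rewrite /= ?e.
  exact: mulr_gt0.
split; first exact: mulr0.
by rewrite -scalemxAr; apply: lex_ltZ.
Qed.

Lemma improves0 : ~ improves 0.
Proof.
by case=> [|[_]] /=; rewrite ?ltxx // mulmx0; apply: lex_lt_irr.
Qed.

(** [Tinj] makes the lexicographic maximiser unique, since all maximisers agree in [beta] and in
    [T y]. *)
Lemma ex_optimal t A : (forall i, 0 <= t i) ->
  exists z, optimal row_owner row_lhs row_rhs improves t A z.
Proof.
move=> t0.
(* The objective [beta] comes first, then the rows of [T], with a minus sign because they are
   minimised; indices beyond [m] get the constant 0. *)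
pose f k (z : E) : R := if k is k'.+1 then
  if insub k' is Some i then - (T *m z.1) (i : 'I_m) 0 else 0 else z.2.
have cf k : continuous (f k).
  case: k => [|k] /=; first exact: snd_continuous.
  rewrite /f; case: insubP => [i _ _|_] z; last exact: cvg_cst.
  apply: cvgN; apply: (@continuous_comp _ _ _ fst (fun y => (T *m y) i 0)).
    exact: cvg_fst.
  exact: mulmx_coord_continuous.
have fS (i : 'I_m) z : f i.+1 z = - (T *m z.1) i 0.
  by rewrite /f valK.
have [|z fz zP] := @compact_lexmax _ _ f [set z | feas t A z] m.+1 _
  (@feasible_compact t A) cf (@feasible_closed t A).
  by exists 0; apply: feasible_origin.
exists z; split => // z' fz' ne; have [[k km [lt eq]]|eq] := zP z' fz'.
  case: k => [|k] in km lt eq *; first by left; rewrite /= subr_gt0.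
  right; split; first by rewrite /= (eq 0%N isT : z'.2 = z.2) subrr.
  rewrite /= mulmxBr -lex_lt_subr; exists (Ordinal (km : (k < m)%N)); split.
    by move: lt; rewrite !(fS (Ordinal (km : (k < m)%N))) ltrN2.
  by move=> j jk; have := eq j.+1 jk; rewrite !fS => /oppr_inj.
case: ne; rewrite [z]surjective_pairing [z']surjective_pairing.
congr (_, _); last exact: (eq 0%N isT : z'.2 = z.2).
apply/eqP; rewrite -subr_eq0; apply/eqP/Tinj; rewrite mulmxBr; apply/eqP.
rewrite subr_eq0; apply/eqP/matrixP => i j; rewrite ord1.
by have := eq i.+1 (ltn_ord i); rewrite !fS => /oppr_inj.
Qed.

(** The pairs are written as row vectors of length [nx + 1], and the coefficients come from a
    nonzero row of the kernel of the matrix that they form. *)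
Lemma linearly_dependent (B : {set J}) (v : J -> E) : (nx.+1 < #|B|)%N ->
  exists c : J -> R, (exists2 i, i \in B & c i != 0) /\
    \sum_(i in B) c i *: v i = 0.
Proof.
move=> nB; pose M : 'M[R]_(#|B|, nx + 1) :=
  \matrix_(k, l) (col_mx (v (enum_val k)).1 ((v (enum_val k)).2)%:M) l 0.
have : kermx M != 0.
  rewrite -mxrank_eq0 mxrank_ker -lt0n subn_gt0.
  by rewrite (leq_ltn_trans (rank_leq_col M)) // addn1.
case/matrix0Pn => a [b nab].
have MM : row a (kermx M) *m M = 0 by rewrite -row_mul mulmx_ker row0.
pose c j := if [pick k | enum_val k == j :> J] is Some k then kermx M a k else 0.
have cE (k : 'I_#|B|) : c (enum_val k) = kermx M a k.
  rewrite /c; case: pickP => [k' /eqP/enum_val_inj -> //|/(_ k)].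
  by rewrite eqxx.
exists c; split; first by exists (enum_val b); rewrite ?enum_valP // cE.
rewrite big_enum_val /=.
under eq_bigr => k _ do rewrite cE.
have sumE l : \sum_(k < #|B|)
    kermx M a k * col_mx (v (enum_val k)).1 ((v (enum_val k)).2)%:M l 0 = 0.
  have /matrixP/(_ 0 l) := MM; rewrite mxE [RHS]mxE => e; rewrite -[RHS]e.
  by apply: eq_bigr => k _; rewrite [row _ _ _ _]mxE [M _ _]mxE.
rewrite [LHS]surjective_pairing; congr (_, _).
  rewrite (big_morph fst (id1 := 0) (op1 := +%R)) //.
  apply/matrixP => i j; rewrite ord1 summxE mxE -[RHS](sumE (lshift 1 i)).
  by apply: eq_bigr => k _; rewrite mxE col_mxEu.
rewrite (big_morph snd (id1 := 0) (op1 := +%R)) // -[RHS](sumE (rshift nx 0)).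
by apply: eq_bigr => k _; rewrite col_mxEd [_%:M _ _]mxE eqxx.
Qed.

End ScenarioProgram.

(** * The optimiser with its tie-breaking rule *)

Section ScenarioRule.
Variables (R : realType) (nv nx : nat) (V : 'M[R]_(nv, nx)) (J : finType).
Variables (p : J -> 'cV[R]_nx) (Wtrue : set 'cV[R]_nx).
Variables (m : nat) (T : 'M[R]_(m, nx)) (opt : set 'cV[R]_nx -> 'cV[R]_nx * R).
Hypothesis cV : compact (polytope V).
Hypothesis sWV : Wtrue `<=` polytope V.
Hypothesis pW : forall j, Wtrue (p j).
Hypothesis optP : lp_rule V Wtrue T opt.

(** The identity rows make the tie-breaking map injective, as [ex_optimal] requires, and never
    decide: [lp_rule] breaks every tie by [T] alone. *)
Let T1 := col_mx T (1%:M : 'M[R]_nx).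

Let T1_inj (y : 'cV[R]_nx) : T1 *m y = 0 -> y = 0.
Proof. by rewrite /T1 mul_col_mx mul1mx => /eqP; rewrite col_mx_eq0 => /andP[_ /eqP]. Qed.

Let pV j : polytope V (p j). Proof. exact/sWV/pW. Qed.

Local Notation feas := (feasible (@row_owner nv J) (row_lhs V (J := J)) (row_rhs V p)).

Lemma feasible_lp (A : {set J}) z :
  feas (@unrelaxed R J) A z <-> lp_feasible V [set p j | j in [set` A]] z.
Proof.
split=> [f|[f1 f2 f3]].
  have [f2 f3] : vle (V *m z.1) (const_mx z.2) /\ 0 <= z.2 <= 1.
    by apply/(feasible0P V p (@unrelaxed R J)); apply: sub_feasible f; exact: finset.sub0set.
  split=> // _ [j jA <-] i; have := f (inl (j, i)) jA.
  by rewrite /relaxed /= /unrelaxed addr0 !mxE; lra.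
case=> [[j i]|r] rA.
  have := f1 (p j) (ex_intro2 _ _ j rA erefl) i.
  by rewrite /relaxed /= /unrelaxed addr0 !mxE; lra.
have := (feasible0P V p (@unrelaxed R J) z).2 (conj f2 f3).
exact.
Qed.

Lemma opt_lexopt (A : {set J}) : A != finset.set0 ->
  opt [set p j | j in [set` A]] =
  lexopt (@row_owner nv J) (row_lhs V (J := J)) (row_rhs V p) (improves T1) (@unrelaxed R J) A.
Proof.
case/set0Pn => j0 j0A; set I := [set p j | j in _].
have [[fo oo] uo] : lp_optimal V I (opt I) /\
    forall z, lp_optimal V I z -> z <> opt I ->
      lex_lt (T *m (opt I).1) (T *m z.1).
  apply: optP.1; first exact/finite_image/finite_finset.
    by exists (p j0), j0.
  by move=> _ [j _ <-]; exact: pW.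
have u0 (i : J) : 0 <= @unrelaxed R J i by [].
apply: optimal_unique (lexoptP (ex_optimal cV pV T1_inj) u0 A).
- exact: improvesD.
- exact: improves0.
split=> [|z /feasible_lp fz nz]; first exact/feasible_lp.
have := oo z fz; rewrite le_eqVlt => /predU1P[e|lt]; last by left; rewrite /= subr_gt0.
right; split; first by rewrite /= e subrr.
rewrite /= mulmxBr -lex_lt_subr /T1 !mul_col_mx; apply: lex_lt_col_mx.
by apply: uo => //; split=> // z' fz'; rewrite e; apply: oo.
Qed.

Lemma violated_row (A : {set J}) j : A != finset.set0 ->
  let z := opt [set p j | j in [set` A]] in
  ~ quantified_set V z (p j) ->
  ~~ satisfied (@row_owner nv J) (row_lhs V (J := J)) (row_rhs V p) (@unrelaxed R J) j z.
Proof.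
move=> A0 z nq; apply/negP => /forallP sat; apply: nq.
have fz : feas (@unrelaxed R J) finset.set0 z.
  apply: (@sub_feasible _ _ _ _ _ _ _ _ A); first exact: finset.sub0set.
  rewrite /z opt_lexopt //; apply: lexopt_feasible => //.
  exact: ex_optimal.
have [f /andP[z0 z1]] := (feasible0P V p (@unrelaxed R J) z).1 fz.
apply/quantified_setE => //=; rewrite z1 => i.
(* For [z.2 = 0] the constraints [V y <= 0] already force [y = 0]. *)
have -> : (if 0 < z.2 then z.1 else 0) = z.1.
  move: z0; rewrite le_eqVlt => /predU1P[e|-> //]; rewrite -e ltxx.
  apply/esym/(polytope_recession cV) => k; apply: le_trans (f k) _.
  by rewrite -e !mxE.
have := sat (inl (j, i)); rewrite eqxx /= /relaxed /= /unrelaxed addr0.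
by lra.
Qed.

(** The pair [(y, beta)] has [nx.+1] coordinates, which bounds the size of the irreducible sets. *)
Lemma card_violated N th : (nx < N)%N -> (0 < th)%N ->
  (#|[set A : {set J} | (#|A| == N) && (th <= #|[set j |
        `[< ~ quantified_set V (opt [set p i | i in [set` A]]) (p j) >]]%SET|)%N]%SET|%:R : R)
  <= few_above R (#|J| - th).+1 nx.+1 N #|J|.
Proof.
move=> nN th0.
apply: le_trans (@card_many_violated R ('cV[R]_nx * R)%type J (lp_row nv J)
  (@row_owner nv J) (row_lhs V (J := J)) (row_rhs V p) (improves T1)
  _ _ _ _ _ _ nx.+1 _ _ N th nN th0).
- rewrite ler_nat; apply: subset_leq_card; apply/fintype.subsetP => A.
  rewrite !finset.inE => /andP[/eqP cA thA]; rewrite cA eqxx /=.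
  apply: leq_trans thA _; apply: subset_leq_card; apply/fintype.subsetP => j.
  rewrite !finset.inE => /asboolP; have A0 : A != finset.set0.
    by rewrite -card_gt0 cA (leq_ltn_trans _ nN).
  by move/(violated_row A0); rewrite opt_lexopt.
- exact: row_lhsD.
- exact: row_lhsZ.
- exact: improvesD.
- exact: improvesZ.
- exact: improves0.
- exact: ex_optimal.
- exact: linearly_dependent.
- apply: violation_stable.
  + exact: row_lhsD.
  + exact: row_lhsZ.
  + exact: improvesD.
  + exact: improvesZ.
  + exact: improves0.
  + exact: ex_optimal.
  + exact: row_lhs_continuous.
  + exact: feasible0_compact.
Qed.

End ScenarioRule.

(** * Independent samples *)

(** The rectangles are closed under intersection and generate the product sigma-algebra. *)
Lemma tuple_measure_unique (R : realType) (d : measure_display)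
    (T : measurableType d) n (m1 m2 : {measure set (n.-tuple T) -> \bar R}) :
  (m1 setT < +oo)%E ->
  (forall A : 'I_n -> set T, (forall i, measurable (A i)) ->
    m1 [set t | forall i, A i (tnth t i)] = m2 [set t | forall i, A i (tnth t i)]) ->
  forall B, measurable B -> m1 B = m2 B.
Proof.
move=> m1oo m12 B mB.
pose G := [set [set t : n.-tuple T | forall i, A i (tnth t i)] |
  A in [set A : 'I_n -> set T | forall i, measurable (A i)]].
have GT : G setT by exists (fun=> setT) => //; apply/seteqP; split.
have mG : G `<=` measurable.
  move=> _ [A mA <-]; have -> : [set t : n.-tuple T | forall i, A i (tnth t i)] =
      \bigcap_(i in [set: 'I_n]) ((@tnth _ T ^~ i) @^-1` A i).
    by apply/seteqP; split=> [t h i _|t h i]; [exact: h|exact: h].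
  apply: fin_bigcap_measurable => // i _.
  by rewrite -[X in measurable X]setTI; exact: measurable_tnth.
apply: (measure_unique G (fun=> setT)) => //.
- apply/seteqP; split; last first.
    by apply: smallest_sub => //; exact: sigma_algebra_measurable.
  have : g_sigma_preimage (fun i (x : n.-tuple T) => tnth x i) `<=` <<s G >>.
    apply: sub_sigma_algebra2; rewrite -bigcup_seq => _ [i _ [A mA <-]].
    rewrite setTI; exists (fun j => if j == i then A else setT) => [j /=|].
      by case: ifP.
    apply/seteqP; split=> [t /(_ i)|t At j] /=; first by rewrite eqxx.
    by case: eqP => // ->.
  exact.
- move=> _ _ [A mA <-] [A' mA' <-]; exists (fun i => A i `&` A' i) => [i|].
    exact: measurableI.
  by apply/seteqP; split=> [t h|t [h h'] i //]; split=> i; have [] := h i.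
- by rewrite bigcup_const //; exists 0%N.
- by move=> _ [A mA <-]; exact: m12.
Qed.

Section IidTuples.
Variables (R : realType) (d d' : measure_display) (T : measurableType d').
Variables (Omega : measurableType d) (P : probability Omega R).
Variables (J : eqType) (X : J -> {RV P >-> T}) (mu : probability T R).
Hypothesis iidX : iid_with_law X mu.

Definition sample_tuple n (r : n.-tuple J) (om : Omega) : n.-tuple T :=
  [tuple of map (fun j => X j om) r].

Lemma measurable_sample_tuple n (r : n.-tuple J) :
  measurable_fun setT (sample_tuple r).
Proof.
apply/measurable_fun_tnthP => i.
rewrite (_ : _ \o _ = X (tnth r i)); first exact: measurable_funPT.
by apply/funext => om; rewrite /= tnth_map.
Qed.

Lemma preimage_law j A : measurable A -> P (X j @^-1` A) = mu A.
Proof. exact: iidX.2. Qed.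

Lemma sample_tuple_rect n (r : n.-tuple J) (A : 'I_n -> set T) : uniq r ->
  (forall i, measurable (A i)) ->
  P [set om | forall i, A i (tnth (sample_tuple r om) i)] = (\prod_i mu (A i))%E.
Proof.
move=> ur mA.
(* Independence is formulated for sets indexed by [J]: the sets [A i] are carried along the
   injective [r], and [setT] is used elsewhere. *)
pose A' j := if [pick i | tnth r i == j] is Some i then A i else setT.
have A'E i : A' (tnth r i) = A i.
  rewrite /A'; case: pickP => [k /eqP/(tuple_uniqP _ ur) -> //|/(_ i)].
  by rewrite eqxx.
have mA' j : measurable (A' j) by rewrite /A'; case: pickP.
have := iidX.1 r A' ur mA'; rewrite big_tuple => e.
transitivity (P [set om | forall j, j \in (r : seq J) -> A' j (X j om)]).
  congr (P _); apply/seteqP; split=> om h.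
    by move=> j /tnthP[i ->]; rewrite A'E; have := h i; rewrite tnth_map.
  by move=> i; rewrite tnth_map -A'E; apply: h; exact: mem_tnth.
by rewrite e; apply: eq_bigr => i _; rewrite A'E preimage_law.
Qed.

(** For fixed [C] both sides are finite measures in [B], so rectangles suffice; a rectangle times
    [C] is again a rectangle, for the tuple [l :: r]. *)
Lemma sample_tuple_independent n (r : n.-tuple J) l B C : uniq (l :: r) ->
  measurable B -> measurable C ->
  P (sample_tuple r @^-1` B `&` X l @^-1` C) = (P (sample_tuple r @^-1` B) * mu C)%E.
Proof.
move=> ulr mB mC; have ur : uniq r by case/andP: ulr.
have mXC : measurable (X l @^-1` C) by rewrite -[X in measurable X]setTI; exact: measurable_funPT.
have mst := measurable_sample_tuple r.
have C0 : 0 <= fine (mu C) by rewrite fine_ge0.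
pose m1 : {measure set (n.-tuple T) -> \bar R} := pushforward (mrestr P mXC) (sample_tuple r).
pose m2 : {measure set (n.-tuple T) -> \bar R} :=
  mscale (NngNum C0) (pushforward P (sample_tuple r)).
have m1E D : m1 mst D = P (sample_tuple r @^-1` D `&` X l @^-1` C) by [].
have m2E D : m2 mst D = ((fine (mu C))%:E * P (sample_tuple r @^-1` D))%E by [].
rewrite -m1E muleC -(fineK (fin_num_measure mu C mC)) -m2E.
apply: tuple_measure_unique mB.
  rewrite m1E preimage_setT setTI; apply: le_lt_trans (probability_le1 _ mXC) _.
  exact: ltry.
move=> A mA; rewrite m1E m2E fineK ?fin_num_measure //.
rewrite [X in (_ * P X)%E](_ : _ = [set om | forall i, A i (tnth (sample_tuple r om) i)]) //.
rewrite sample_tuple_rect //.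
pose A' (i : 'I_n.+1) := if unlift ord0 i is Some k then A k else C.
have mA' i : measurable (A' i) by rewrite /A'; case: (unlift _ _).
have := sample_tuple_rect (r := [tuple of l :: r]) ulr mA'.
rewrite big_ord_recl [X in (mu X * _)%E](_ : _ = C); last by rewrite /A' unlift_none.
rewrite [X in (_ * X)%E](_ : _ = (\prod_i mu (A i))%E); last first.
  by apply: eq_bigr => i _; rewrite /A' liftK.
move=> <-; congr (P _); apply/seteqP; split=> om.
  case=> h XC i; rewrite /A'; case: unliftP => [k ->|->].
    by rewrite tnth_map tnthS /=; have := h k; rewrite tnth_map.
  by rewrite tnth_map.
move=> h; split=> [i|].
  by have := h (lift ord0 i); rewrite /A' liftK !tnth_map tnthS.
by have := h ord0; rewrite /A' unlift_none tnth_map.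
Qed.

End IidTuples.

(** Lets the given samples be traded for those of an infinite i.i.d. sequence, which also provides
    the fresh ones. *)
Lemma sample_tuple_law (R : realType) (d1 d2 d' : measure_display) (T : measurableType d')
    (O1 : measurableType d1) (P1 : probability O1 R)
    (O2 : measurableType d2) (P2 : probability O2 R)
    (J1 J2 : eqType) (X1 : J1 -> {RV P1 >-> T}) (X2 : J2 -> {RV P2 >-> T})
    (mu : probability T R) n (r1 : n.-tuple J1) (r2 : n.-tuple J2) B :
  iid_with_law X1 mu -> iid_with_law X2 mu -> uniq r1 -> uniq r2 -> measurable B ->
  P1 (sample_tuple X1 r1 @^-1` B) = P2 (sample_tuple X2 r2 @^-1` B).
Proof.
move=> iid1 iid2 u1 u2 mB.
have mst1 := measurable_sample_tuple X1 r1; have mst2 := measurable_sample_tuple X2 r2.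
pose m1 : {measure set (n.-tuple T) -> \bar R} := pushforward P1 (sample_tuple X1 r1).
pose m2 : {measure set (n.-tuple T) -> \bar R} := pushforward P2 (sample_tuple X2 r2).
apply: (@tuple_measure_unique _ _ _ _ (m1 mst1) (m2 mst2)) => //.
  by rewrite /m1 /= /pushforward preimage_setT probability_setT ltry.
move=> A mA; rewrite /m1 /m2 /= /pushforward.
by rewrite [LHS](sample_tuple_rect iid1) // [RHS](sample_tuple_rect iid2).
Qed.

(** * A weak law for the empirical violation *)

Section Centred.
Variables (R : realType) (d d1 d2 : measure_display).
Variables (Omega : measurableType d) (P : probability Omega R).
Variables (T1 : measurableType d1) (T2 : measurableType d2).
Variables (mu : probability T2 R).

Lemma bounded_integrable_probability d' (T : measurableType d')
    (nu : probability T R) (f : T -> R) (M : R) :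
  measurable_fun setT f -> (forall x, `|f x| <= M) ->
  nu.-integrable setT (EFin \o f).
Proof.
move=> mf fM; apply: measurable_bounded_integrable => //.
  by rewrite (le_lt_trans (probability_le1 nu measurableT)) ?ltry.
exists M; split; first exact: num_real.
by move=> x Mx t _; exact: le_trans (fM t) (ltW Mx).
Qed.

(** Independence makes the law of the pair a product measure, and Fubini's theorem integrates over
    the second component first. *)
Lemma integral_centred (X : Omega -> T1) (W : Omega -> T2) (G : T1 * T2 -> R) (M : R) :
  measurable_fun setT X -> measurable_fun setT W ->
  (forall B C, measurable B -> measurable C ->
    P (X @^-1` B `&` W @^-1` C) = (P (X @^-1` B) * mu C)%E) ->
  measurable_fun setT G -> (forall z, `|G z| <= M) ->
  (forall x, (\int[mu]_y (G (x, y))%:E = 0)%E) ->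
  (\int[P]_om (G (X om, W om))%:E = 0)%E.
Proof.
move=> mX mW ind mG GM G0.
have mXW : measurable_fun setT (fun om => (X om, W om)) by exact: measurable_fun_pair.
pose X' : {RV P >-> T1} := HB.pack X (isMeasurableFun.Build _ _ _ _ X mX).
pose XW : {RV P >-> (T1 * T2)%type} :=
  HB.pack (fun om => (X om, W om)) (isMeasurableFun.Build _ _ _ _ _ mXW).
have intXW : (distribution P XW).-integrable setT (EFin \o G).
  exact: bounded_integrable_probability GM.
have mG' : measurable_fun setT (fun z => (G z)%:E) by exact/measurable_EFinP.
have lawXW A : measurable A -> (distribution P X' \x mu)%E A = distribution P XW A.
  apply: product_measure_unique => B C mB mC.
  exact: ind.
transitivity (\int[distribution P XW]_z (G z)%:E)%E.
  rewrite (integral_distribution mG') //.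
  apply: (@bounded_integrable_probability _ _ P (G \o XW) M) => [|x].
    exact: measurableT_comp mG mXW.
  exact: GM.
transitivity (\int[distribution P X' \x mu]_z (G z)%:E)%E.
  by apply: eq_measure_integral => A mA _; exact/esym/lawXW.
rewrite -integral12_prod_meas1.
  by rewrite integral0_eq // => x _; exact: G0.
have := intXW; move=> /integrableP[m1 i1]; apply/integrableP; split => //.
rewrite [ltLHS](_ : _ = \int[distribution P XW]_z `|(G z)%:E|)%E //.
apply: eq_measure_integral => A mA _.
exact: lawXW.
Qed.

End Centred.

Section WeakLaw.
Variables (R : realType) (d d1 d2 : measure_display).
Variables (Omega : measurableType d) (P : probability Omega R).
Variables (T1 : measurableType d1) (T2 : measurableType d2).
Variables (mu : probability T2 R) (I : finType).
Variables (Z : Omega -> T1) (W : I -> Omega -> T2) (S : set (T1 * T2)).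
Hypothesis mZ : measurable_fun setT Z.
Hypothesis mW : forall i, measurable_fun setT (W i).
Hypothesis mS : measurable S.
Hypothesis indW : forall i j, i != j -> forall B C, measurable B -> measurable C ->
  P ((fun om => (Z om, W i om)) @^-1` B `&` W j @^-1` C) =
  (P ((fun om => (Z om, W i om)) @^-1` B) * mu C)%E.

Definition section_prob (z : T1) : R := fine (mu (xsection S z)).

Lemma section_prob01 z : 0 <= section_prob z <= 1.
Proof.
have mx : measurable (xsection S z) by exact: measurable_xsection.
rewrite /section_prob fine_ge0 //= -lee_fin fineK ?fin_num_measure //.
exact: probability_le1.
Qed.

Lemma measurable_section_prob : measurable_fun setT section_prob.
Proof.
apply: measurableT_comp; first exact: fine_measurable.
exact: measurable_fun_xsection.
Qed.

Let F (x : T1 * T2) : R := section_prob x.1 - \1_S x.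

Let mF : measurable_fun setT F.
Proof.
apply: measurable_funB; last exact: measurable_indic.
by apply: measurableT_comp; first exact: measurable_section_prob.
Qed.

Let F1 x : `|F x| <= 1.
Proof.
rewrite /F indicE; have /andP[] := section_prob01 x.1.
by case: (x \in S); rewrite ler_norml /=; lra.
Qed.

Let intF z : (\int[mu]_y (F (z, y))%:E = 0)%E.
Proof.
have mx : measurable (xsection S z) by exact: measurable_xsection.
rewrite /F; under eq_integral do rewrite EFinB.
rewrite integralB_EFin //=.
  rewrite integral_cst // [X in (_ * X)%E](_ : _ = 1%E) ?mule1; last exact: probability_setT.
  rewrite (_ : (fun y => _) = (fun y => (\1_(xsection S z) y)%:E)); last first.
    by apply/funext => y; rewrite !indicE mem_xsection.
  rewrite integral_indic // setIT /section_prob fineK ?fin_num_measure //.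
  by rewrite subee // fin_num_measure.
- exact: (@bounded_integrable_probability _ _ _ mu (cst (section_prob z)) `|section_prob z|).
- apply: (@bounded_integrable_probability _ _ _ mu (fun y => \1_S (z, y)) 1).
    rewrite (_ : (fun y => _) = \1_(xsection S z)); first exact: measurable_indic.
    by apply/funext => y; rewrite !indicE mem_xsection.
  by move=> y; rewrite indicE; case: (_ \in _); rewrite ?normr1 ?normr0.
Qed.

Let mFW i : measurable_fun setT (fun om => F (Z om, W i om)).
Proof.
by apply: (measurableT_comp mF); apply: measurable_fun_pair.
Qed.

Let FF1 x y : `|F x * F y| <= 1.
Proof. by rewrite normrM mulr_ile1. Qed.

Let mFF i j : measurable_fun setT (fun om => F (Z om, W i om) * F (Z om, W j om)).
Proof. exact: measurable_funM. Qed.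

(** For [i != j] the factor with [W j] has mean 0 given [Z] and [W i]; the diagonal terms are at
    most 1. *)
Let intFF i j :
  (\int[P]_om (F (Z om, W i om) * F (Z om, W j om))%:E <= (i == j)%:R%:E)%E.
Proof.
have [->|ij] := eqVneq i j.
  apply: le_trans (_ : \int[P]_om (cst 1 om) <= _)%E; last first.
    by rewrite integral_cst // mul1e probability_le1.
  apply: ge0_le_integral => //.
  - by move=> om _; rewrite lee_fin -expr2 sqr_ge0.
  - exact/measurable_EFinP.
  - by move=> om _; rewrite lee_fin (le_trans (ler_norm _)).
pose G (x : T1 * T2 * T2) := F x.1 * F (x.1.1, x.2).
rewrite (_ : (\int[P]_om _ = \int[P]_om (G ((Z om, W i om), W j om))%:E)%E) //.
rewrite (@integral_centred _ _ _ _ _ P _ _ mu (fun om => (Z om, W i om)) (W j) G 1) //.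
- exact: measurable_fun_pair.
- exact: indW.
- apply: measurable_funM; first exact: (measurableT_comp mF).
  apply: (measurableT_comp mF); apply: measurable_fun_pair => //.
  exact: measurableT_comp.
- by move=> z; exact: FF1.
move=> x; rewrite /G /=; under eq_integral do rewrite EFinM.
rewrite integralZl //; first by rewrite intF mule0.
apply: (@bounded_integrable_probability _ _ _ mu (fun y => F (x.1, y)) 1) => //.
by apply: (measurableT_comp mF); exact: measurable_pair1.
Qed.

(** Chebyshev's inequality: on [D] the sum [Y] of the centred indicators is at least [del * #|I|],
    while its second moment is at most [#|I|] because the cross terms vanish. *)
Lemma weak_law (eps del : R) : 0 < del -> (0 < #|I|)%N ->
  let D := [set om | eps < section_prob (Z om) /\
     \sum_i \1_S (Z om, W i om) <= (eps - del) * #|I|%:R] in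
  measurable D /\ (P D <= (del ^- 2 / #|I|%:R)%:E)%E.
Proof.
move=> del0 I0 D; have n0 : 0 < #|I|%:R :> R by rewrite ltr0n.
have mv : measurable_fun setT (fun om => section_prob (Z om)).
  exact: measurableT_comp measurable_section_prob mZ.
have mD : measurable D.
  have -> : D = ~` (setT `&` [set om | section_prob (Z om) <= eps]) `&`
     (setT `&` [set om | \sum_i \1_S (Z om, W i om) <= (eps - del) * #|I|%:R]).
    rewrite !setTI; apply/seteqP; split=> om [].
      by move=> lt le; split => //=; apply/negP; rewrite -ltNge.
    by move=> /= /negP; rewrite -ltNge.
  apply: measurableI; first by apply: measurableC; exact: measurable_fun_le.
  apply: measurable_fun_le => //.
  apply: measurable_sum => i; apply: measurableT_comp (measurable_indic _) _ => //.
  exact: measurable_fun_pair.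
split=> //.
pose Y om := \sum_i F (Z om, W i om).
have mY : measurable_fun setT Y by exact: measurable_sum.
have YE om : Y om = #|I|%:R * section_prob (Z om) - \sum_i \1_S (Z om, W i om).
  by rewrite /Y sumrB /= sumr_const mulr_natl.
have Y2 : (\int[P]_om (Y om ^+ 2)%:E <= #|I|%:R%:E)%E.
  rewrite (_ : (\int[P]_om _ =
    \int[P]_om (\sum_i \sum_j (F (Z om, W i om) * F (Z om, W j om))%:E))%E); last first.
    apply: eq_integral => om _; rewrite expr2 /Y mulr_suml -sumEFin.
    by apply: eq_bigr => i _; rewrite mulr_sumr -sumEFin.
  have iFF i j : P.-integrable setT (fun om => (F (Z om, W i om) * F (Z om, W j om))%:E).
    exact: (@bounded_integrable_probability _ _ _ P
      (fun om => F (Z om, W i om) * F (Z om, W j om)) 1).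
  rewrite integral_sum //; last by move=> i; exact: integrable_sum.
  apply: le_trans (_ : \sum_(i : I) 1%:E <= _)%E; last first.
    by rewrite sumEFin sumr_const.
  apply: lee_sum => i _; rewrite integral_sum //.
  apply: le_trans (lee_sum _ (fun j _ => intFF i j)) _.
  by rewrite sumEFin (bigD1 i) //= eqxx big1 ?addr0 // => j /negbTE; rewrite eq_sym => ->.
have YD : (((del * #|I|%:R) ^+ 2)%:E * P D <= \int[P]_om (Y om ^+ 2)%:E)%E.
  rewrite -[D in P D]setIT -integral_indic // -ge0_integralZl_EFin //;
    [|by apply/measurable_EFinP; exact: measurable_indic|exact: sqr_ge0].
  apply: ge0_le_integral => //.
  - by move=> om _; rewrite -EFinM lee_fin mulr_ge0 // ?sqr_ge0 // indicE.
  - by apply/measurable_EFinP; apply: measurable_funM => //; exact: measurable_indic.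
  - by apply/measurable_EFinP; exact: measurable_funX.
  move=> om _; rewrite -EFinM lee_fin indicE; case: (boolP (om \in D)); last first.
    by rewrite mulr0 sqr_ge0.
  rewrite inE mulr1 => -[lt le]; rewrite ler_pXn2r ?nnegrE //.
  - by rewrite YE; nra.
  - by rewrite mulr_ge0 // ltW.
  - rewrite YE; nra.
have := le_trans YD Y2; rewrite -(fineK (fin_num_measure P D mD)) -EFinM !lee_fin => le.
rewrite ler_pdivlMr // -(ler_pM2l (exprn_gt0 2 del0)) mulrA.
rewrite [_ * _ ^- 2]mulfV ?expf_neq0 ?gt_eqF //.
rewrite -(ler_pM2r n0) mul1r; apply: le_trans le.
by rewrite le_eqVlt; apply/orP; left; apply/eqP; ring.
Qed.

End WeakLaw.

(** * Borel sets of vectors *)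

Lemma open_nbhsP (T : topologicalType) (A : set T) :
  (forall x, A x -> nbhs x A) -> open A.
Proof. by rewrite openE. Qed.

Section BorelVectors.
Variables (R : realType) (n : nat).

Lemma open_measurable_cV (U : set 'cV[R]_n) : open U -> measurable U.
Proof. by move=> oU; apply: sub_sigma_algebra. Qed.

Lemma continuous_measurable_cV (f : 'cV[R]_n -> R) :
  continuous f -> measurable_fun setT f.
Proof.
move=> /continuousP cf; apply: (measurability _ (RGenOpens.measurableE R)).
move=> _ [_ [a [b ->] <-]]; rewrite setTI.
by apply: open_measurable_cV; apply: cf; exact: interval_open.
Qed.

Variable mu : probability 'cV[R]_n R.

Lemma closed_msupport : closed (msupport mu).
Proof.
rewrite -openC; apply: open_nbhsP => x /existsNP[U].
move=> /not_implyP[oU /not_implyP[Ux nU]].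
have : nbhs x U by exact: open_nbhs_nbhs.
apply: filterS => y Uy /(_ U oU Uy); exact: nU.
Qed.

Lemma measurable_msupport : measurable (msupport mu).
Proof.
rewrite -[X in measurable X]setCK; apply: measurableC; apply: open_measurable_cV.
exact: closed_openC closed_msupport.
Qed.

Definition rat_box (q : {ffun 'I_n -> rat * rat}) : set 'cV[R]_n :=
  [set y | forall i, ratr (q i).1 < y i 0 < ratr (q i).2].

Lemma measurable_rat_box q : measurable (rat_box q).
Proof.
have -> : rat_box q = \bigcap_(i in [set: 'I_n])
    ((fun y : 'cV[R]_n => y i 0) @^-1` `]ratr (q i).1, ratr (q i).2[).
  apply/seteqP; split=> y h i; first by move=> _; rewrite /= in_itv; exact: h.
  by have := h i I; rewrite /= in_itv.
apply: fin_bigcap_measurable => // i _; rewrite -[X in measurable X]setTI.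
by apply: continuous_measurable_cV => //; exact: coord_continuous.
Qed.

Lemma rat_box_nbhs (U : set 'cV[R]_n) x : nbhs x U ->
  exists2 q, rat_box q x & rat_box q `<=` U.
Proof.
move=> /nbhs_ballP[e /= e0 eU].
have /choice[q qP] (i : 'I_n) : exists q : rat * rat,
    x i 0 - e < ratr q.1 < x i 0 /\ x i 0 < ratr q.2 < x i 0 + e.
  have /rat_in_itvoo[a] : x i 0 - e < x i 0 by rewrite ltrBlDr ltrDl.
  have /rat_in_itvoo[b] : x i 0 < x i 0 + e by rewrite ltrDl.
  by rewrite !in_itv /= => hb ha; exists (a, b).
exists [ffun i => q i] => [i|y yq].
  by rewrite ffunE; have [/andP[_ ->] /andP[->]] := qP i.
apply: eU; split=> // i j; rewrite ord1 -ball_normE /=.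
have := yq i; rewrite ffunE; have [] := qP i.
by rewrite ltr_norml; lra.
Qed.

(** Every point off the support lies in a rational box of measure 0, and there are only countably
    many such boxes. *)
Lemma msupport_full : mu (msupport mu) = 1%E.
Proof.
pose F k := if unpickle k is Some q then
  if mu (rat_box q) == 0%E then rat_box q else set0 else set0.
have nF : mu.-negligible (~` msupport mu).
  have : ~` msupport mu `<=` \bigcup_k F k.
    move=> x /existsNP[U] /not_implyP[oU /not_implyP[Ux nU]].
    have [q qx qU] := rat_box_nbhs (open_nbhs_nbhs (conj oU Ux)).
    exists (pickle q) => //; rewrite /F pickleK ifT //.
    rewrite eq_le measure_ge0 andbT; apply: (le_trans (y := mu U)).
      by apply: le_measure; rewrite ?inE //; [exact: measurable_rat_box|exact: open_measurable_cV].
    by rewrite leNgt; apply/negP.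
  move/negligibleS; apply; apply: negligible_bigcup => k; rewrite /F.
  case: (unpickle k) => [q|]; last exact: negligible_set0.
  case: eqP => q0; last exact: negligible_set0.
  by apply/negligibleP => //; exact: measurable_rat_box.
have mC : measurable (~` msupport mu) by apply: measurableC; exact: measurable_msupport.
have mS := measurable_msupport; move/negligibleP: nF => /(_ mC).
rewrite -(probability_setT mu) -(setUv (msupport mu)) => mu0.
rewrite measureU ?setICr //; apply/esym.
by rewrite [X in (_ + X)%E]mu0 adde0.
Qed.

End BorelVectors.

Section ViolationSet.
Variables (R : realType) (nv nx : nat) (V : 'M[R]_(nv, nx)).
Hypothesis cV : compact (polytope V).

Lemma measurable_quantified_set :
  measurable [set x : ('cV[R]_nx * R) * 'cV[R]_nx | quantified_set V x.1 x.2].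
Proof.
have mVw r : measurable_fun setT (fun x : ('cV[R]_nx * R) * 'cV[R]_nx => (V *m x.2) r 0).
  apply: (measurableT_comp (continuous_measurable_cV (@mulmx_coord_continuous R _ _ V r))).
  exact: measurable_snd.
have mz2 : measurable_fun setT (fun x : ('cV[R]_nx * R) * 'cV[R]_nx => x.1.2).
  by apply: (measurableT_comp measurable_snd); exact: measurable_fst.
have mVy r : measurable_fun setT (fun x : ('cV[R]_nx * R) * 'cV[R]_nx =>
    (V *m (if 0 < x.1.2 then x.1.1 else 0)) r 0).
  rewrite (_ : (fun x => _) = (fun x : ('cV[R]_nx * R) * 'cV[R]_nx =>
    if 0 < x.1.2 then (V *m x.1.1) r 0 else 0)); last first.
    by apply/funext => x; case: ifP => // _; rewrite mulmx0 mxE.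
  apply: measurable_fun_ifT => //; first exact: measurable_fun_ltr.
  apply: (measurableT_comp (continuous_measurable_cV (@mulmx_coord_continuous R _ _ V r))).
  by apply: (measurableT_comp measurable_fst); exact: measurable_fst.
pose f r (x : ('cV[R]_nx * R) * 'cV[R]_nx) :=
  (V *m x.2) r 0 - (V *m (if 0 < x.1.2 then x.1.1 else 0)) r 0.
have mf r : measurable_fun setT (f r) by exact: measurable_funB.
have m1z : measurable_fun setT (fun x : ('cV[R]_nx * R) * 'cV[R]_nx => 1 - x.1.2).
  exact: measurable_funB.
pose A := setT `&` [set x : ('cV[R]_nx * R) * 'cV[R]_nx | x.1.2 <= 1].
have mA : measurable A by exact: measurable_fun_le.
rewrite (_ : [set x | _] =
  (A `&` \bigcap_(r in [set: 'I_nv]) (setT `&` [set x | f r x <= 1 - x.1.2])) `|`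
  (~` A `&` \bigcap_(r in [set: 'I_nv]) (setT `&` [set x | 1 - x.1.2 <= f r x]))).
  apply: measurableU; apply: measurableI => //; try exact: measurableC;
  by apply: fin_bigcap_measurable => // r _; exact: measurable_fun_le.
rewrite /A setTI; apply/seteqP; split=> x.
  move=> /(quantified_setE cV) /=; case: ifP => x1 h; [left|right].
    by split => // r _; split=> //; exact: h.
  by split => // r _; split=> //; exact: h.
case=> -[/= x1 h]; apply/(quantified_setE cV) => /=.
  by rewrite x1 => r; have [] := h r I.
by case: ifP => [/x1 //|_] r; have [] := h r I.
Qed.

Lemma measurable_violation (Wtrue : set 'cV[R]_nx) : measurable Wtrue ->
  measurable [set x : ('cV[R]_nx * R) * 'cV[R]_nx |
    Wtrue x.2 /\ ~ quantified_set V x.1 x.2].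
Proof.
move=> mW; apply: measurableI; last first.
  by apply: measurableC; exact: measurable_quantified_set.
by rewrite -[X in measurable X]setTI; exact: measurable_snd.
Qed.

End ViolationSet.

(** * The violation probability *)

(** Integrates the pointwise bound on the number of events that occur. *)
Lemma sum_probability_le (R : realType) (d : measure_display) (Omega : measurableType d)
    (P : probability Omega R) (I : finType) (A : {set I}) (H : I -> set Omega) (c : R) :
  (forall i, measurable (H i)) ->
  (forall om, \sum_(i in A) \1_(H i) om <= c) ->
  (\sum_(i in A) P (H i) <= c%:E)%E.
Proof.
move=> mH Hc; have c0 : 0 <= c.
  by apply: le_trans (Hc point); apply: sumr_ge0 => i _; rewrite indicE.
rewrite (_ : (\sum_(i in A) P (H i))%E = (\int[P]_om (\sum_(i in A) \1_(H i) om)%:E)%E).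
  apply: (@le_trans _ _ (\int[P]_om cst c%:E om)%E).
    apply: ge0_le_integral => //.
    - by move=> om _; rewrite lee_fin sumr_ge0 // => i _; rewrite indicE.
    - apply/measurable_EFinP; under eq_fun do rewrite -big_enum.
      by apply: measurable_sum => i; exact: measurable_indic.
    - by move=> om _; rewrite lee_fin.
  by rewrite integral_cst // [X in (_ * X)%E](_ : _ = 1%E) ?mule1 //; exact: probability_setT.
under [RHS]eq_integral do rewrite -sumEFin -big_enum.
rewrite ge0_integral_sum //.
- by rewrite big_enum; apply: eq_bigr => i _; rewrite integral_indic // setIT.
- by move=> i; apply/measurable_EFinP; exact: measurable_indic.
Qed.

Section Assembly.
Variables (R : realType) (nx nv : nat) (V : 'M[R]_(nv, nx)).
Variables (Wtrue : set 'cV[R]_nx) (Pr : probability 'cV[R]_nx R).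
Variables (d : measure_display) (Omega : measurableType d) (P : probability Omega R).
Variables (m : nat) (T : 'M[R]_(m, nx)) (opt : set 'cV[R]_nx -> 'cV[R]_nx * R).
Hypothesis cV : compact (polytope V).
Hypothesis sWV : Wtrue `<=` polytope V.
Hypothesis supp : msupport Pr = Wtrue.
Hypothesis optP : lp_rule V Wtrue T opt.

Definition violation : set (('cV[R]_nx * R) * 'cV[R]_nx) :=
  [set x | Wtrue x.2 /\ ~ quantified_set V x.1 x.2].

Let mWtrue : measurable Wtrue.
Proof. by rewrite -supp; exact: measurable_msupport. Qed.

Let mviol : measurable violation.
Proof. exact: measurable_violation. Qed.

Definition violation_prob (z : 'cV[R]_nx * R) : R := section_prob Pr violation z.

Lemma violation_probE z :
  Pr [set wr | Wtrue wr /\ ~ quantified_set V z wr] = (violation_prob z)%:E.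
Proof.
have mx : measurable (xsection violation z) by exact: measurable_xsection.
rewrite /violation_prob /section_prob fineK ?fin_num_measure //; congr (Pr _).
by apply/seteqP; split=> y; rewrite /xsection /= inE.
Qed.

Definition risky N (eps : R) : set (N.-tuple 'cV[R]_nx) :=
  [set s : N.-tuple 'cV[R]_nx | eps < violation_prob (opt [set` s])].

Lemma measurable_risky N eps : measurable (@risky N eps).
Proof.
have mv : measurable_fun setT (fun s : N.-tuple 'cV[R]_nx => violation_prob (opt [set` s])).
  exact: measurableT_comp (measurable_section_prob Pr mviol) (optP.2 N).
rewrite (_ : risky eps = ~` (setT `&`
    [set s : N.-tuple 'cV[R]_nx | violation_prob (opt [set` s]) <= eps])).
  by apply: measurableC; exact: measurable_fun_le.
rewrite setTI; apply/seteqP; split=> s /=.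
  by move=> lt; apply/negP; rewrite -ltNge.
by move/negP; rewrite -ltNge.
Qed.

Variable w : nat -> {RV P >-> 'cV[R]_nx}.
Hypothesis iidw : iid_with_law w Pr.

Section SubsampleOptimiser.
Variables (M : nat).
Implicit Types A : {set 'I_M}.

Definition sub_opt A om := opt [set w i om | i in [set` A]].

Definition sub_indices A : #|A|.-tuple nat := map_tuple val (enum_tuple A).

Lemma uniq_sub_indices A : uniq (sub_indices A).
Proof. by rewrite map_inj_uniq ?enum_uniq //; exact: val_inj. Qed.

Lemma sub_optE A om : sub_opt A om = opt [set` sample_tuple w (sub_indices A) om].
Proof.
congr opt; apply/seteqP; split=> y /=.
  by move=> [i iA <-]; apply: map_f; apply: map_f; rewrite mem_enum.
by move=> /mapP[k /mapP[i]]; rewrite mem_enum => iA -> ->; exists i.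
Qed.

Lemma measurable_sub_opt A : measurable_fun setT (sub_opt A).
Proof.
rewrite (_ : sub_opt A = (fun s : #|A|.-tuple 'cV[R]_nx => opt [set` s]) \o
    sample_tuple w (sub_indices A)); last by apply/funext => om; exact: sub_optE.
exact: measurableT_comp (optP.2 _) (measurable_sample_tuple w (sub_indices A)).
Qed.

(** The pair is a Borel function of the tuple of the samples with indices [i] and those in [A], and
    [j] is not among these. *)
Lemma sub_opt_independent A (i j : 'I_M) B C :
  i \notin A -> j \notin A -> i != j -> measurable B -> measurable C ->
  P ((fun om => (sub_opt A om, w i om)) @^-1` B `&` w j @^-1` C) =
  (P ((fun om => (sub_opt A om, w i om)) @^-1` B) * Pr C)%E.
Proof.
move=> iA jA ij mB mC.
pose r := [tuple of val i :: sub_indices A].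
pose f (t : #|A|.+1.-tuple 'cV[R]_nx) := (opt [set` [tuple of behead t]], tnth t ord0).
have mf : measurable_fun setT f.
  apply: measurable_fun_pair; last exact: measurable_tnth.
  exact: measurableT_comp (optP.2 _) (@measurable_behead _ _ _).
have -> : (fun om => (sub_opt A om, w i om)) @^-1` B = sample_tuple w r @^-1` (f @^-1` B).
  have fE om : f (sample_tuple w r om) = (sub_opt A om, w i om).
    by rewrite /f sub_optE tnth_map.
  by apply/seteqP; split=> om /=; rewrite fE.
apply: (sample_tuple_independent iidw) => //; last first.
  by rewrite -[X in measurable X]setTI; exact: mf.
have nA k : k \notin A -> val k \notin sub_indices A.
  by rewrite mem_map ?mem_enum //; exact: val_inj.
by rewrite /= uniq_sub_indices !inE negb_or !nA // eq_sym (inj_eq val_inj) ij.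
Qed.

(** Exchangeability: the probability depends on [A] only through its size. *)
Lemma sub_opt_law A eps (d' : measure_display) (Omega' : measurableType d')
    (P' : probability Omega' R) (J : eqType) (w' : J -> {RV P' >-> 'cV[R]_nx})
    (r' : #|A|.-tuple J) :
  iid_with_law w' Pr -> uniq r' ->
  P [set om | eps < violation_prob (sub_opt A om)] =
  P' (sample_tuple w' r' @^-1` risky eps).
Proof.
move=> iidw' ur'.
rewrite -(sample_tuple_law iidw iidw' (uniq_sub_indices A) ur' (measurable_risky eps)).
by congr (P _); apply/seteqP; split=> om /=; rewrite /risky /= sub_optE.
Qed.

End SubsampleOptimiser.

(** * Double counting over subsamples *)

Section Counting.
Variables (N n : nat) (eps del q : R).
Hypothesis nN : (nx < N)%N.
Hypothesis n0 : (0 < n)%N.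
Hypothesis del0 : 0 < del.
Hypothesis de : 0 <= eps - del <= 1.
Hypothesis qE : forall A : {set 'I_(N + n)}, #|A| = N ->
  P [set om | eps < violation_prob (sub_opt A om)] = q%:E.

Let rest (A : {set 'I_(N + n)}) (k : 'I_#|~: A|) : 'I_(N + n) := enum_val k.

(** The samples outside [A] are the fresh ones; on this event their violation frequency falls short
    of the violation probability by more than [del]. *)
Let deviant (A : {set 'I_(N + n)}) : set Omega :=
  [set om | eps < violation_prob (sub_opt A om) /\
    \sum_k \1_violation (sub_opt A om, w (@rest A k) om) <= (eps - del) * #|'I_#|~: A| |%:R].

Let deviantP (A : {set 'I_(N + n)}) : #|A| = N -> measurable (deviant A) /\
  (P (deviant A) <= (del ^- 2 / n%:R)%:E)%E.
Proof.
move=> cA; have cI : #|'I_#|~: A| | = n by rewrite card_ord cardsCs finset.setCK card_ord cA addKn.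
rewrite -cI; apply: weak_law => //.
- exact: measurable_sub_opt.
- move=> k l kl B C mB mC; apply: sub_opt_independent => //.
  + by have := enum_valP k; rewrite finset.inE.
  + by have := enum_valP l; rewrite finset.inE.
  + by rewrite (inj_eq enum_val_inj).
- by rewrite cI.
Qed.

Let typical : set Omega := \bigcap_(i in [set: 'I_(N + n)]) (w i @^-1` Wtrue).

Let typicalP : measurable typical /\ P (~` typical) = 0%E.
Proof.
have mw (i : 'I_(N + n)) : measurable (w i @^-1` Wtrue).
  by rewrite -[X in measurable X]setTI; exact: measurable_funPT.
have mt : measurable typical by exact: fin_bigcap_measurable.
split=> //; apply/negligibleP; first exact: measurableC.
rewrite setC_bigcap (_ : \bigcup_(i in _) _ =
  \big[setU/set0]_(i : 'I_(N + n)) ~` (w i @^-1` Wtrue)); last first.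
  by rewrite -bigcup_seq; apply/seteqP; split=> om [i _ h]; exists i => //=; rewrite mem_index_enum.
elim/big_ind: _ => [|X Y nX nY|i _]; first exact: negligible_set0.
  exact: negligibleU.
apply/negligibleP; first exact: measurableC.
apply: etrans (probability_setC P (mw i)) _.
have -> : P (w i @^-1` Wtrue) = 1%E.
  by rewrite (preimage_law iidw _ mWtrue) -supp msupport_full.
exact: subee.
Qed.

Let bad (A : {set 'I_(N + n)}) : set Omega :=
  ([set om | eps < violation_prob (sub_opt A om)] `\` deviant A) `&` typical.

Let mrisk (A : {set 'I_(N + n)}) : measurable [set om | eps < violation_prob (sub_opt A om)].
Proof.
rewrite (_ : [set om | _] = sample_tuple w (sub_indices A) @^-1` risky eps).
  rewrite -[X in measurable X]setTI; apply: measurable_sample_tuple => //.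
  exact: measurable_risky.
by apply/seteqP; split=> om /=; rewrite /risky /= sub_optE.
Qed.

(** On a typical outcome every bad [A] is violated by more than [(eps - del) * n] of the samples, so
    that the deterministic count applies; elsewhere no [A] is bad. *)
Let sum_bad om :
  \sum_(A : {set 'I_(N + n)} | #|A| == N) \1_(bad A) om <=
  few_above R (N + n - (Num.truncn ((eps - del) * n%:R)).+1).+1 nx.+1 N (N + n).
Proof.
have [tom|ntom] := pselect (typical om); last first.
  rewrite big1 ?few_above_ge0 // => A _; rewrite indicE memNset //.
  by move=> [_].
have pW (j : 'I_(N + n)) : Wtrue (w j om) by exact: tom.
have := card_violated cV sWV pW optP nN (ltn0Sn (Num.truncn ((eps - del) * n%:R))).
rewrite card_ord; apply: le_trans.
under eq_bigr do rewrite indicE.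
rewrite -natr_sum -big_mkcondr sum1dep_card ler_nat.
apply: subset_leq_card; apply/fintype.subsetP => A; rewrite !finset.inE.
case/andP => /eqP cA; rewrite inE => -[[lt nd] _]; rewrite cA eqxx /=.
have cI : #|'I_#|~: A| | = n by rewrite card_ord cardsCs finset.setCK card_ord cA addKn.
have {nd} : (eps - del) * n%:R < \sum_k \1_violation (sub_opt A om, w (@rest A k) om).
  by rewrite ltNge; apply/negP => le; apply: nd; split; rewrite ?cI.
have en0 : 0 <= (eps - del) * n%:R by case/andP: de => e0 _; rewrite mulr_ge0.
under eq_bigr do rewrite indicE.
rewrite -natr_sum -truncn_lt_nat // => /leq_trans; apply.
rewrite -big_mkcond sum1dep_card -(card_imset _ (@enum_val_inj _ (mem (~: A)))).
apply: subset_leq_card; apply/fintype.subsetP => j /imsetP[k].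
rewrite finset.inE => /set_mem[_ nq] ->; rewrite finset.inE; exact/asboolP.
Qed.

(** The probabilities of the bad events, each at least [q - del ^- 2 / n], are summed over all
    [N]-subsets, and [few_above] bounds the sum. *)
Lemma risky_le :
  q <= expR (nx%:R - N%:R * ((eps - del) * (1 - (expR 1)^-1)) + N%:R * N.+1%:R / n%:R)
       + del ^- 2 / n%:R.
Proof.
have [mt t0] := typicalP.
have mbad (A : {set 'I_(N + n)}) : #|A| = N -> measurable (bad A).
  by move=> cA; apply: measurableI => //; apply: measurableD => //; have [] := deviantP cA.
have qbad (A : {set 'I_(N + n)}) : #|A| = N ->
    ((q - del ^- 2 / n%:R)%:E <= P (bad A))%E.
  move=> cA; have [md Pd] := deviantP cA; have mb := mbad A cA.
  have mbd := measurableU _ _ mb md; have mtC := measurableC mt.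
  rewrite EFinB leeBlDr // -(qE cA).
  apply: le_trans (_ : P (bad A `|` deviant A `|` ~` typical) <= _)%E.
    apply: le_measure; rewrite ?inE //.
      exact: measurableU mbd mtC.
    move=> om r; have [td|nt] := pselect (typical om); last by right.
    by left; have [dd|nd] := pselect (deviant A om); [right|left].
  apply: le_trans (measureU2 P mbd mtC) _; rewrite [X in (_ + X)%E]t0 adde0.
  by apply: le_trans (measureU2 P mb md) _; exact: leeD2l.
pose H (A : {set 'I_(N + n)}) := if #|A| == N then bad A else set0.
have mH A : measurable (H A) by rewrite /H; case: eqP => // cA; exact: mbad.
pose few := few_above R (N + n - (Num.truncn ((eps - del) * n%:R)).+1).+1 nx.+1 N (N + n).
have sumH : (\sum_(A in [set A : {set 'I_(N + n)} | #|A| == N]%SET) P (H A) <= few%:E)%E.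
  apply: sum_probability_le => // om.
  under eq_bigl do rewrite finset.inE; under eq_bigr => A cA do rewrite /H cA.
  exact: sum_bad.
have cardN : #|[set A : {set 'I_(N + n)} | #|A| == N]%SET| = 'C(N + n, N).
  have := card_draws 'I_(N + n) N; rewrite card_ord => <-.
  by apply: eq_card => A; rewrite !finset.inE.
have le1 : 'C(N + n, N)%:R * (q - del ^- 2 / n%:R) <= few.
  rewrite -lee_fin; apply: le_trans sumH.
  rewrite mulr_natl -cardN -sumr_const -sumEFin; apply: lee_sum => A.
  by rewrite finset.inE /H => cA; rewrite cA; apply/qbad/eqP.
have C0 : 0 < 'C(N + n, N)%:R :> R by rewrite ltr0n bin_gt0 leq_addr.
rewrite -lerBlDr -(ler_pM2l C0); apply: le_trans le1 _; rewrite mulrC.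
apply: few_above_expR => //; first by apply: leq_trans nN.
by apply: leq_ltn_trans nN.
Qed.

End Counting.

Lemma expR_affine_continuous (a b : R) : continuous (fun t : R => b * expR (a * t) + t).
Proof.
move=> t; apply: cvgD; last exact: cvg_id.
apply: (@cvg_comp _ _ _ (fun t => expR (a * t)) ( *%R b) _ (nbhs (expR (a * t)))).
  apply: (@cvg_comp _ _ _ ( *%R a) expR _ (nbhs (a * t))); last exact: continuous_expR.
  exact: mulrl_continuous.
exact: mulrl_continuous.
Qed.

Lemma risky_le_gamma (N : nat) (eps gamma q : R) : 0 < eps < 1 -> 0 < gamma < 1 ->
  eps^-1 * (expR 1 / (expR 1 - 1)) * (ln gamma^-1 + nx%:R) <= N%:R ->
  (forall M (A : {set 'I_M}), #|A| = N ->
    P [set om | eps < violation_prob (sub_opt A om)] = q%:E) ->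
  q <= gamma.
Proof.
move=> /andP[e0 e1] /andP[g0 g1] hN qE.
have nN : (nx < N)%N by apply: (sample_size_gt (eps := eps) (gamma := gamma)); rewrite ?e0 ?g0.
(* With [del = t] and [n = t ^- 3] both errors vanish as [t] tends to 0: [del ^- 2 / n] is [t], and
   the exponent grows by at most [N * t + N * N.+1 * t]. *)
pose f (t : R) := gamma * expR (N%:R * N.+2%:R * t) + t.
have key (k : nat) : k.+1%:R^-1 <= eps -> q <= f k.+1%:R^-1.
  set t := k.+1%:R^-1 => te.
  have t0 : 0 < t by rewrite invr_gt0.
  have t1 : t <= 1 by rewrite invf_le1 // ler1n.
  have := @risky_le N (k.+1 ^ 3) eps t q nN; rewrite expn_gt0 => /(_ isT t0).
  have -> : 0 <= eps - t <= 1 by lra.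
  move=> /(_ isT (fun A cA => qE _ A cA)) /le_trans; apply.
  have tk : (k.+1 ^ 3)%:R^-1 = t ^+ 3 :> R by rewrite natrX exprVn.
  rewrite tk /f; apply: lerD; last first.
    have -> : t ^- 2 * t ^+ 3 = t by field; rewrite gt_eqF.
    exact: lexx.
  apply: le_trans (ler_wpM2r (expR_ge0 _) (sample_size_bound e0 g0 hN)).
  rewrite -expRD ler_expR; set kk := 1 - (expR 1)^-1.
  have k1 : kk <= 1 by rewrite /kk gerBl invr_ge0 expR_ge0.
  have t3 : t ^+ 3 <= t by rewrite exprS ler_piMr ?exprn_ile1 // ltW.
  have N0 : 0 <= N%:R :> R by [].
  rewrite -[N.+2%:R]natr1 -[N.+1%:R]natr1.
  have h1 : N%:R * (t * kk) <= N%:R * t by rewrite ler_wpM2l // ler_piMr // ltW.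
  have h2 : N%:R * (N%:R + 1) * t ^+ 3 <= N%:R * (N%:R + 1) * t.
    by rewrite ler_wpM2l // mulr_ge0 // addr_ge0.
  by rewrite mulrBl mulrBr; lra.
have cf : f k.+1%:R^-1 @[k --> \oo] --> gamma.
  rewrite -[X in _ --> X](_ : f 0 = gamma); last by rewrite /f mulr0 expR0 mulr1 addr0.
  apply: (@continuous_cvg _ _ _ _ _ _ f); last exact: cvg_harmonic.
  exact: expR_affine_continuous.
apply: (cvgr_to_ge cf); exists (Num.truncn eps^-1) => // k /= kP; apply: key.
rewrite invf_ple ?posrE //; apply/ltW; apply: lt_le_trans (_ : (Num.truncn eps^-1).+1%:R <= _).
  by rewrite real_truncnS_gt ?num_real.
by rewrite ler_nat.
Qed.

End Assembly.

Theorem theorem3 (R : realType) (nx nu nv : nat)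
    (A : 'M[R]_nx) (B : 'M[R]_(nx, nu)) (V : 'M[R]_(nv, nx))
    (Wtrue : set 'cV[R]_nx) (Pr : probability 'cV[R]_nx R)
    (d : measure_display) (Omega : measurableType d) (P : probability Omega R)
    (x : nat -> Omega -> 'cV[R]_nx) (u : nat -> Omega -> 'cV[R]_nu)
    (w : nat -> {RV P >-> 'cV[R]_nx})
    (N : nat) (ws : 'I_N -> {RV P >-> 'cV[R]_nx})
    (m : nat) (T : 'M[R]_(m, nx)) (opt : set 'cV[R]_nx -> 'cV[R]_nx * R)
    (eps gamma : R) :
  stabilisable A B ->
  (forall k om, x k.+1 om = A *m x k om + B *m u k om + w k om) ->
  compact (polytope V) ->
  convex_set Wtrue ->
  Wtrue `<=` polytope V ->
  msupport Pr = Wtrue ->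
  iid_with_law w Pr ->
  iid_with_law ws Pr ->
  lp_rule V Wtrue T opt ->
  0 < eps < 1 ->
  0 < gamma < 1 ->
  eps^-1 * (expR 1 / (expR 1 - 1)) * (ln gamma^-1 + nx%:R) <= N%:R ->
  ((1 - gamma)%:E <=
     P [set om | Pr [set wr | Wtrue wr /\
          ~ quantified_set V (opt [set ws s om | s in [set: 'I_N]]) wr]
        <= eps%:E])%E.
Proof.
move=> _ _ cV _ sWV supp iidw iidws optP eps01 gamma01 hN.
pose r := ord_tuple N.
have ur : uniq r by rewrite val_ord_tuple enum_uniq.
have rE om : [set ws s om | s in [set: 'I_N]] = [set` sample_tuple ws r om].
  apply/seteqP; split=> y /=.
    by move=> [s _ <-]; apply: map_f; rewrite val_ord_tuple mem_enum.
  by move=> /mapP[s _ ->]; exists s.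
pose risk := sample_tuple ws r @^-1` risky V Wtrue Pr opt eps.
have mrisk : measurable risk.
  rewrite -[X in measurable X]setTI; apply: measurable_sample_tuple => //.
  exact: (measurable_risky cV supp optP).
have -> : [set om | (Pr [set wr | Wtrue wr /\
    ~ quantified_set V (opt [set ws s om | s in [set: 'I_N]]) wr] <= eps%:E)%E] = ~` risk.
  apply/seteqP; split=> om; rewrite /= (violation_probE cV supp) lee_fin rE.
    by rewrite leNgt => /negP.
  by move/negP; rewrite -leNgt.
have Pf : P risk \is a fin_num by exact: fin_num_measure.
rewrite probability_setC // -(fineK Pf) -EFinB lee_fin lerD2l lerN2.
apply: (risky_le_gamma cV sWV supp optP iidw eps01 gamma01 hN) => M C cC.
rewrite fineK //.
(* The samples [ws] replace the subsample [C] of the sequence [w]; the cast adjusts the length of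
   the tuple from [N] to [#|C|]. *)
rewrite (sub_opt_law cV supp optP iidw eps (r' := tcast (esym cC) r) iidws); last first.
  by rewrite val_tcast.
have sE om : [set` sample_tuple ws (tcast (esym cC) r) om] = [set` sample_tuple ws r om].
  by apply/funext => y; rewrite /= !memtE /= val_tcast.
by congr (P _); apply/seteqP; split=> om; rewrite /risk /risky /= sE.
Qed.
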